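(* Let $F_n$ be the free group of rank $n$. If $n\ge3$, then both $\mathrm{Aut}(F_n)$ and $\mathrm{Out}(F_n)$ are algebraically thick of order at most one.
   Context: Unconstricted groups. For a finitely generated group with a word metric, an asymptotic cone is an $\omega$-ultralimit of $(G,1,\frac1{d_n}\mathrm{dist})$ for a non-principal ultrafilter $\omega$ on $\mathbb N$ and positive $d_n$ with $\lim_\omega d_n=\infty$. An infinite finitely generated group is unconstricted if at least one of its asymptotic cones has no global cut-points (a singleton is considered to have a cut-point). Undistorted subgroup: a finitely generated subgroup $H$ of $G$ such that any word metric on $H$ is bi-Lipschitz equivalent to the restriction to $H$ of a word metric of $G$. Algebraic network. Let $G$ be a finitely generated group, $\mathcal H$ a finite non-empty collection of subgroups and $M>0$. $G$ is an $M$-algebraic network with respect to $\mathcal H$ if: (AN$_0$) all subgroups in $\mathcal H$ are finitely generated and undistorted in $G$; (AN$_1$) there is a finite index subgroup $G_1$ of $G$ such that $G$ is contained in the $M$-neighborhood of $G_1$ and a finite generating set of $G_1$ is contained in $\bigcup_{H\in\mathcal H}H$; (AN$_2$) any $H,H'\in\mathcal H$ are joined by a finite sequence $H=H_1,\dots,H_k=H'$ in $\mathcal H$ with $H_i\cap H_{i+1}$ infinite for all $1\le i<k$. Algebraic thickness. $G$ is algebraically thick of order zero if it is unconstricted; it is algebraically thick of order at most one if it is unconstricted or if, for some $M>0$ and some finite collection $\mathcal H$ of unconstricted subgroups, it is an $M$-algebraic network with respect to $\mathcal H$. *)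

(* Defs.v *)
From HB Require Import structures.
From mathcomp Require Import all_boot all_order all_algebra.
From mathcomp Require Import all_classical all_reals all_analysis.

Set Implicit Arguments.
Unset Strict Implicit.
Unset Printing Implicit Defensive.

Import Order.TTheory GRing.Theory Num.Theory.
Import numFieldNormedType.Exports.

Local Open Scope classical_set_scope.
Local Open Scope ring_scope.
Local Open Scope quotient_scope.

(* [(x, false)] is the generator x and [(x, true)] its inverse. *)
Definition letter (X : Type) : Type := (X * bool)%type.

Definition inv_letter X (a : letter X) : letter X := (a.1, ~~ a.2).

Section FreeGroup.
Variable X : choiceType.
Implicit Types (a b : letter X) (u v w : seq (letter X)).

Definition reduced w : bool := sorted (fun a b => b != inv_letter a) w.

Record free_group : Type := FreeGroup {
  free_word :> seq (letter X);
  free_wordP : reduced free_word }.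

HB.instance Definition _ := [isSub for free_word].
HB.instance Definition _ := [Choice of free_group by <:].

Definition free_push a w : seq (letter X) :=
  if w is b :: w' then if b == inv_letter a then w' else a :: w else [:: a].

Definition free_mul_word u v := foldr free_push v u.
Definition free_inv_word u := rev (map (@inv_letter X) u).

Lemma inv_letterK : involutive (@inv_letter X).
Proof. by case=> x b; rewrite /inv_letter /= negbK. Qed.

Lemma reduced_push a w : reduced w -> reduced (free_push a w).
Proof.
case: w => [|b w] //= bw; case: ifPn => [_|ba /=]; first exact: path_sorted bw.
by rewrite ba.
Qed.

Lemma reduced_mul u v : reduced v -> reduced (free_mul_word u v).
Proof. by move=> rv; elim: u => [|a u] //= ; exact: reduced_push. Qed.

Lemma reduced_inv u : reduced u -> reduced (free_inv_word u).
Proof.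
rewrite /reduced /free_inv_word rev_sorted sorted_map; apply: sub_sorted => a b.
by rewrite /= inv_letterK eq_sym.
Qed.

Lemma free_pushK a w : reduced w -> free_push a (free_push (inv_letter a) w) = w.
Proof.
case: w => [|b w] /=; first by rewrite eqxx.
rewrite inv_letterK; case: (eqVneq b a) => [->|ba _]; last by rewrite /= eqxx.
by case: w => [|c w] //= /andP[/negPf ->].
Qed.

Lemma free_mul_push a v w : reduced v -> reduced w ->
  free_mul_word (free_push a v) w = free_push a (free_mul_word v w).
Proof.
case: v => [|b v] //= rv rw; case: eqP => [->|//].
by rewrite free_pushK // reduced_mul.
Qed.

Lemma free_mul_wordA u v w : reduced v -> reduced w ->
  free_mul_word u (free_mul_word v w) = free_mul_word (free_mul_word u v) w.
Proof.
by move=> rv rw; elim: u => //= a u ->; rewrite free_mul_push // reduced_mul.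
Qed.

Lemma free_mul_word1 u : reduced u -> free_mul_word u [::] = u.
Proof.
elim: u => //= a u IH ru; rewrite IH; last exact: path_sorted ru.
by case: u ru {IH} => //= b u /andP[/negPf ->].
Qed.

Lemma free_mul_wordV u : reduced u -> free_mul_word (free_inv_word u) u = [::].
Proof.
elim: u => // a u IH ru.
rewrite /free_mul_word /free_inv_word /= rev_cons foldr_rcons /= inv_letterK eqxx.
by apply: IH; exact: path_sorted ru.
Qed.

Lemma free_inv_wordK u : free_inv_word (free_inv_word u) = u.
Proof. by rewrite /free_inv_word map_rev revK mapK //; exact: inv_letterK. Qed.

Definition free_one : free_group := @FreeGroup [::] isT.
Definition free_mul (f g : free_group) : free_group :=
  FreeGroup (reduced_mul f (free_wordP g)).
Definition free_inv (f : free_group) : free_group :=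
  FreeGroup (reduced_inv (free_wordP f)).

Lemma free_mulA : associative free_mul.
Proof.
by move=> f g h; apply: val_inj; apply: free_mul_wordA; exact: free_wordP.
Qed.

Lemma free_mul1g : left_id free_one free_mul.
Proof. by move=> f; apply: val_inj. Qed.

Lemma free_mulg1 : right_id free_one free_mul.
Proof. by move=> f; apply: val_inj; exact/free_mul_word1/free_wordP. Qed.

Lemma free_mulVg : left_inverse free_one free_inv free_mul.
Proof. by move=> f; apply: val_inj; exact/free_mul_wordV/free_wordP. Qed.

Lemma free_mulgV : right_inverse free_one free_inv free_mul.
Proof.
move=> f; apply: val_inj; rewrite /= -[X in free_mul_word X _]free_inv_wordK.
exact/free_mul_wordV/reduced_inv/free_wordP.
Qed.

HB.instance Definition _ :=
  isGroup.Build free_group free_mulA free_mul1g free_mulg1 free_mulVg free_mulgV.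

End FreeGroup.

Section Aut.
Variable G : groupType.
Local Open Scope group_scope.

Definition is_automorphism (f : G -> G) : Prop :=
  bijective f /\ {morph f : x y / x * y}.

Record Aut : Type := MkAut {
  aut_fun :> G -> G;
  aut_funP : `[< is_automorphism aut_fun >] }.

HB.instance Definition _ := [isSub for aut_fun].
HB.instance Definition _ := [Choice of Aut by <:].

Lemma autP (f : Aut) : is_automorphism f.
Proof. exact/asboolP/(aut_funP f). Qed.

Lemma is_automorphism_id : is_automorphism idfun.
Proof. by split=> //; exists id. Qed.

Lemma is_automorphism_comp (f g : Aut) : is_automorphism (f \o g).
Proof.
have [[bf mf] [bg mg]] := (autP f, autP g).
by split=> [|x y /=]; [exact: bij_comp | rewrite mg mf].
Qed.

Lemma is_automorphism_inv (f : Aut) : exists g, is_automorphism g /\ cancel f g.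
Proof.
have [[g fK gK] mf] := autP f; exists g; split=> //; split; first by exists f.
by move=> x y; apply: (can_inj fK); rewrite mf !gK.
Qed.

Definition aut_one : Aut := MkAut (introT (asboolP _) is_automorphism_id).

(* the product of Aut is composition: (f * g) x = f (g x) *)
Definition aut_mul (f g : Aut) : Aut :=
  MkAut (introT (asboolP _) (is_automorphism_comp f g)).

Definition aut_inv (f : Aut) : Aut :=
  MkAut (introT (asboolP _) (projT2 (cid (is_automorphism_inv f))).1).

Lemma aut_eqP (f g : Aut) : f =1 g -> f = g.
Proof. by move=> fg; apply: val_inj; apply/funext. Qed.

Lemma aut_mulA : associative aut_mul.
Proof. by move=> f g h; apply: aut_eqP. Qed.

Lemma aut_mul1g : left_id aut_one aut_mul.
Proof. by move=> f; apply: aut_eqP. Qed.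

Lemma aut_mulg1 : right_id aut_one aut_mul.
Proof. by move=> f; apply: aut_eqP. Qed.

Lemma aut_mulVg : left_inverse aut_one aut_inv aut_mul.
Proof.
move=> f; apply: aut_eqP => x /=.
exact: (projT2 (cid (is_automorphism_inv f))).2.
Qed.

Lemma aut_mulgV : right_inverse aut_one aut_inv aut_mul.
Proof.
move=> f; apply: aut_eqP => x; have [bf _] := autP f.
apply: (bij_inj (proj1 (autP (aut_inv f)))).
by have /(congr1 (fun h : Aut => h (aut_inv f x))) := aut_mulVg f.
Qed.

HB.instance Definition _ :=
  isGroup.Build Aut aut_mulA aut_mul1g aut_mulg1 aut_mulVg aut_mulgV.

Definition inner (f : Aut) : Prop := exists g : G, forall x, f x = x ^ g.

Lemma inner1 : inner 1.
Proof. by exists 1 => x; rewrite conjg1. Qed.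

Lemma innerM (f h : Aut) : inner f -> inner h -> inner (f * h).
Proof.
move=> [a fa] [b hb]; exists (b * a) => x.
by rewrite conjgM -hb -fa.
Qed.

Lemma innerV (f : Aut) : inner f -> inner f^-1.
Proof.
move=> [a fa]; exists a^-1 => x; apply: (bij_inj (proj1 (autP f))).
have -> : f (f^-1 x) = (f * f^-1) x by [].
by rewrite mulgV fa conjgKV.
Qed.

Lemma innerJ (f h : Aut) : inner f -> inner (f ^ h).
Proof.
move=> [a fa]; exists ((h^-1 : Aut) a) => x; rewrite /conjg.
set k : Aut := h^-1; have kM : {morph k : y z / y * z} by case: (autP k).
have kh y : k (h y) = y.
  by have -> : k (h y) = (h^-1 * h) y by []; rewrite mulVg.
have k1 : k 1 = 1 by apply: (mulgI (k 1)); rewrite -kM !mulg1.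
have kV y : k y^-1 = (k y)^-1.
  by apply: (mulgI (k y)); rewrite -kM !mulgV.
have -> : (k * (f * h)) x = k (f (h x)) by [].
by rewrite fa /conjg !kM kV kh.
Qed.

(* f and h represent the same outer automorphism: f Inn(G) = h Inn(G) *)
Definition out_rel (f h : Aut) : bool := `[< inner (f^-1 * h) >].

Lemma out_rel_refl : reflexive out_rel.
Proof. by move=> f; apply/asboolP; rewrite mulVg; exact: inner1. Qed.

Lemma out_rel_sym : symmetric out_rel.
Proof.
move=> f h; apply/asboolP/asboolP => /innerV; by rewrite invgM invgK.
Qed.

Lemma out_rel_trans : transitive out_rel.
Proof.
move=> g f h /asboolP fg /asboolP gh; apply/asboolP.
by have := innerM fg gh; rewrite mulgA -(mulgA f^-1) mulgV mulg1.
Qed.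

Canonical out_equiv :=
  EquivRel out_rel out_rel_refl out_rel_sym out_rel_trans.

Definition Out : Type := {eq_quot out_equiv}.
HB.instance Definition _ := Choice.on Out.
HB.instance Definition _ := EqQuotient.on Out.

Definition out_class (f : Aut) : Out := \pi_Out f.
Definition out_one : Out := out_class 1.
Definition out_mul (x y : Out) : Out := out_class (repr x * repr y).
Definition out_inv (x : Out) : Out := out_class (repr x)^-1.

Lemma out_classP (f h : Aut) : out_class f = out_class h <-> inner (f^-1 * h).
Proof.
split=> [/eqmodP/asboolP //|ih].
by apply/eqmodP; exact/asboolP.
Qed.

Lemma out_classK (x : Out) : out_class (repr x) = x.
Proof. exact: reprK. Qed.

Lemma out_classM (f h : Aut) : out_mul (out_class f) (out_class h) = out_class (f * h).
Proof.
apply/esym/out_classP.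
have /out_classP if' : out_class f = out_class (repr (out_class f)).
  by rewrite out_classK.
have /out_classP ih : out_class h = out_class (repr (out_class h)).
  by rewrite out_classK.
move: (repr (out_class f)) (repr (out_class h)) if' ih => f' h' if' ih.
have := innerM (innerJ h if') ih.
by rewrite /conjg invgM !mulgA mulgK.
Qed.

Lemma out_classV (f : Aut) : out_inv (out_class f) = out_class f^-1.
Proof.
apply/out_classP.
have /esym/out_classP := out_classK (out_class f).
move: (repr (out_class f)) => f' if'.
by have := innerJ f^-1 if'; rewrite /conjg !invgK !mulgA mulgV mul1g.
Qed.

Lemma out_ind (P : Out -> Prop) : (forall f, P (out_class f)) -> forall x, P x.
Proof. by move=> Pf x; rewrite -(out_classK x). Qed.

Lemma out_mulA : associative out_mul.
Proof.
by elim/out_ind=> f; elim/out_ind=> g; elim/out_ind=> h; rewrite !out_classM mulgA.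
Qed.

Lemma out_mul1g : left_id out_one out_mul.
Proof. by elim/out_ind=> f; rewrite out_classM mul1g. Qed.

Lemma out_mulg1 : right_id out_one out_mul.
Proof. by elim/out_ind=> f; rewrite out_classM mulg1. Qed.

Lemma out_mulVg : left_inverse out_one out_inv out_mul.
Proof. by elim/out_ind=> f; rewrite out_classV out_classM mulVg. Qed.

Lemma out_mulgV : right_inverse out_one out_inv out_mul.
Proof. by elim/out_ind=> f; rewrite out_classV out_classM mulgV. Qed.

HB.instance Definition _ :=
  isGroup.Build Out out_mulA out_mul1g out_mulg1 out_mulVg out_mulgV.

End Aut.

Section WordMetric.
Variable G : groupType.
Implicit Types (S H : set G) (g h : G) (w : seq G).
Local Open Scope group_scope.
Local Notation invg := (fun x : G => x^-1).

Definition is_subgroup H : Prop :=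
  [/\ H 1, (forall g h, H g -> H h -> H (g * h)) & (forall g, H g -> H g^-1)].

(* words in S and S^-1; S itself need not be symmetric *)
Definition signed_word S w : Prop := forall x, x \in w -> S x \/ S x^-1.

Definition word_val w : G := \prod_(x <- w) x.

Definition gen S : set G := [set word_val w | w in signed_word S].

(* the least length of a word representing g; it is 0 outside [gen S] *)
Definition word_norm S g : nat :=
  if pselect (exists k, `[< exists w, [/\ signed_word S w, word_val w = g & size w = k] >])
    is left ex then ex_minn ex else 0%N.

Definition word_dist S g h : nat := word_norm S (g^-1 * h).

Lemma signed_word_cat S u v :
  signed_word S u -> signed_word S v -> signed_word S (u ++ v).
Proof. by move=> Su Sv x; rewrite mem_cat => /orP[/Su|/Sv]. Qed.

Lemma word_val_cat u v : word_val (u ++ v) = word_val u * word_val v.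
Proof. by rewrite /word_val big_cat. Qed.

Lemma signed_word_inv S w :
  signed_word S w -> signed_word S (rev (map invg w)).
Proof.
move=> Sw x; rewrite mem_rev => /mapP[y /Sw Sy ->].
by rewrite invgK; case: Sy; [right | left].
Qed.

Lemma word_val_inv w : word_val (rev (map invg w)) = (word_val w)^-1.
Proof.
rewrite /word_val; elim: w => [|x w IH]; first by rewrite /= !big_nil invg1.
by rewrite /= rev_cons -cats1 big_cat /= IH big_seq1 big_cons invgM.
Qed.

Lemma gen_subgroup S : is_subgroup (gen S).
Proof.
split.
- by exists [::]; rewrite /word_val ?big_nil.
- move=> _ _ [u Su <-] [v Sv <-]; exists (u ++ v); last exact: word_val_cat.
  exact: signed_word_cat.
- move=> _ [u Su <-]; exists (rev (map invg u)); last exact: word_val_inv.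
  exact: signed_word_inv.
Qed.

Lemma word_norm_le S w : signed_word S w -> (word_norm S (word_val w) <= size w)%N.
Proof.
move=> Sw; rewrite /word_norm; case: pselect => // ex.
by case: ex_minnP => m _; apply; apply/asboolP; exists w.
Qed.

Lemma word_normP S g : gen S g ->
  exists w, [/\ signed_word S w, word_val w = g & size w = word_norm S g].
Proof.
move=> [w Sw wg]; rewrite /word_norm; case: pselect => [ex|[]].
  by case: ex_minnP => m /asboolP.
by exists (size w); apply/asboolP; exists w.
Qed.

Lemma word_norm1 S : word_norm S 1 = 0%N.
Proof.
have := @word_norm_le S [::]; rewrite /word_val big_nil leqn0 => h.
by apply/eqP/h.
Qed.

Lemma word_norm_eq0 S g : gen S g -> word_norm S g = 0%N -> g = 1.
Proof.
move=> /word_normP[w [_ wg sz]] w0; move: sz wg; rewrite w0 => /size0nil -> <-.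
by rewrite /word_val big_nil.
Qed.

Lemma word_normM S g h : gen S g -> gen S h ->
  (word_norm S (g * h) <= word_norm S g + word_norm S h)%N.
Proof.
move=> /word_normP[u [Su <- <-]] /word_normP[v [Sv <- <-]].
by rewrite -word_val_cat -size_cat word_norm_le //; exact: signed_word_cat.
Qed.

Lemma word_normV S g : gen S g -> word_norm S g^-1 = word_norm S g.
Proof.
suff le h : gen S h -> (word_norm S h^-1 <= word_norm S h)%N.
  move=> Sg; apply/eqP; rewrite eqn_leq le //=.
  rewrite -[X in (word_norm S X <= _)%N]invgK le //.
  by have [_ _] := gen_subgroup S; apply.
move=> /word_normP[u [Su <- <-]].
rewrite -word_val_inv -(size_map invg) -size_rev word_norm_le //.
exact: signed_word_inv.
Qed.

Lemma word_dist_sym S g h : gen S g -> gen S h -> word_dist S g h = word_dist S h g.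
Proof.
have [_ SM SV] := gen_subgroup S.
by move=> Sg Sh; rewrite /word_dist -word_normV ?invgM ?invgK //; apply: SM=> //; exact: SV.
Qed.

Lemma word_dist_triangle S g h k : gen S g -> gen S h -> gen S k ->
  (word_dist S g k <= word_dist S g h + word_dist S h k)%N.
Proof.
have [_ SM SV] := gen_subgroup S => Sg Sh Sk; rewrite /word_dist.
have -> : g^-1 * k = (g^-1 * h) * (h^-1 * k) by rewrite mulgA mulgK.
by apply: word_normM; apply: SM => //; exact: SV.
Qed.

End WordMetric.

(* The alias carries R and S because the metric structure depends on both. *)
Definition word_space (R : realType) (G : groupType) (S : set G) : Type := gen S.

Section WordSpace.
Variables (R : realType) (G : groupType) (S : set G).
Local Notation T := (word_space R S).
Implicit Types x y z : T.

HB.instance Definition _ := Choice.copy T (set_type (gen S)).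

Definition word_space_val (x : T) : G := \val (x : gen S).

Lemma word_space_valP x : gen S (word_space_val x).
Proof. exact: set_valP. Qed.

Definition word_space_dist x y : R :=
  (word_dist S (word_space_val x) (word_space_val y))%:R.

Lemma word_space_distxx x : word_space_dist x x = 0.
Proof. by rewrite /word_space_dist /word_dist mulVg word_norm1. Qed.

Lemma word_space_dist_positivity x y : word_space_dist x y = 0 -> x = y.
Proof.
have [_ SM SV] := gen_subgroup S.
move=> /eqP; rewrite pnatr_eq0 => /eqP xy; apply: val_inj.
have /(congr1 (fun g => word_space_val x * g)%g) :
    ((word_space_val x)^-1 * word_space_val y = 1)%g.
  apply: (word_norm_eq0 _ xy); apply: SM; last exact: word_space_valP.
  exact/SV/word_space_valP.
by rewrite mulgA mulgV mul1g mulg1.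
Qed.

Lemma word_space_dist_sym x y : word_space_dist x y = word_space_dist y x.
Proof.
by rewrite /word_space_dist word_dist_sym //; exact: word_space_valP.
Qed.

Lemma word_space_dist_triangle y x z :
  word_space_dist x z <= word_space_dist x y + word_space_dist y z.
Proof.
rewrite /word_space_dist -natrD ler_nat.
by apply: word_dist_triangle; exact: word_space_valP.
Qed.

HB.instance Definition _ := isMetric.Build R T word_space_distxx
  word_space_dist_positivity word_space_dist_sym word_space_dist_triangle.

Definition word_space1 : T :=
  exist _ 1%g (mem_set (let: And3 S1 _ _ := gen_subgroup S in S1)).

End WordSpace.

Lemma ultra_fmap (T U : Type) (f : T -> U) (F : set_system T) :
  UltraFilter F -> UltraFilter (f @ F).
Proof.
move=> FU; split; first exact: fmap_proper_filter.
move=> G GF sFG; rewrite predeqE => A; split; last exact: sFG.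
move=> GA; have [//|FnA] := in_ultra_setVsetC (f @^-1` A) FU.
have GnA : G (~` A) by exact: sFG.
by have [x []] := filter_ex (filterI GA GnA).
Qed.

Record scaling (R : realType) : Type := Scaling {
  scale_ultra : set_system nat;
  scale_ultraP : UltraFilter scale_ultra;
  scale_nonprincipal : forall n, ~ scale_ultra [set n];
  scale_seq :> nat -> R;
  scale_gt0 : forall n, 0 < scale_seq n;
  scale_cvg : scale_seq @ scale_ultra --> +oo }.

#[global] Existing Instance scale_ultraP.

Section Cone.
Variables (R : realType) (X : metricType R) (x0 : X) (d : scaling R).
Local Notation w := (scale_ultra d).

Definition cone_bounded (x : nat -> X) : Prop :=
  exists C : R, \forall n \near w, mdist x0 (x n) / d n <= C.

Record cone_seq : Type := ConeSeq {
  cone_fun :> nat -> X;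
  cone_funP : `[< cone_bounded cone_fun >] }.

HB.instance Definition _ := [isSub for cone_fun].
HB.instance Definition _ := [Choice of cone_seq by <:].
Implicit Types x y z : cone_seq.

Definition cone_seq_dist x y : R := lim ((fun n => mdist (x n) (y n) / d n) @ w).

Lemma cone_seq_cvg x y : cvg ((fun n => mdist (x n) (y n) / d n) @ w).
Proof.
have [/asboolP[C xC] /asboolP[D yD]] := (cone_funP x, cone_funP y).
set f := fun n => _; have uf : UltraFilter (f @ w) by exact: ultra_fmap.
have := @segment_compact R 0 (C + D); rewrite compact_ultra => /(_ _ uf) [].
  suff : \forall n \near w, f n \in `[0, C + D]%R by [].
  near=> n; rewrite in_itv /= /f divr_ge0 ?mdist_ge0 ?(ltW (scale_gt0 _ _)) //=.
  have xCn : mdist x0 (x n) / d n <= C by near: n.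
  have yDn : mdist x0 (y n) / d n <= D by near: n.
  apply: le_trans (lerD xCn yDn).
  rewrite -mulrDl ler_pM2r ?invr_gt0 ?scale_gt0 //.
  by rewrite [mdist x0 _]metric_sym metric_triangle.
by move=> l [_ fl]; apply/cvg_ex; exists l.
Unshelve. all: by end_near. Qed.

Lemma cone_seq_distxx x : cone_seq_dist x x = 0.
Proof.
rewrite /cone_seq_dist; under eq_fun do rewrite mdistxx mul0r.
exact: lim_cst.
Qed.

Lemma cone_seq_dist_sym x y : cone_seq_dist x y = cone_seq_dist y x.
Proof. by rewrite /cone_seq_dist; under eq_fun do rewrite metric_sym. Qed.

Lemma cone_seq_dist_triangle y x z :
  cone_seq_dist x z <= cone_seq_dist x y + cone_seq_dist y z.
Proof.
have [xy yz] := (@cone_seq_cvg x y, @cone_seq_cvg y z).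
rewrite /cone_seq_dist -(limD xy yz).
apply: ler_lim; [exact: cone_seq_cvg | exact: is_cvgD | near=> n].
by rewrite /= -mulrDl ler_pM2r ?invr_gt0 ?scale_gt0 // metric_triangle.
Unshelve. all: by end_near. Qed.

Lemma cone_seq_dist_ge0 x y : 0 <= cone_seq_dist x y.
Proof.
have := cone_seq_dist_triangle y x x.
rewrite cone_seq_distxx [cone_seq_dist y x]cone_seq_dist_sym -mulr2n.
by rewrite pmulrn_lge0.
Qed.

Definition cone_rel x y : bool := cone_seq_dist x y == 0.

Lemma cone_rel_refl : reflexive cone_rel.
Proof. by move=> x; rewrite /cone_rel cone_seq_distxx. Qed.

Lemma cone_rel_sym : symmetric cone_rel.
Proof. by move=> x y; rewrite /cone_rel cone_seq_dist_sym. Qed.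

Lemma cone_rel_trans : transitive cone_rel.
Proof.
move=> y x z /eqP xy /eqP yz; rewrite /cone_rel eq_le cone_seq_dist_ge0 andbT.
by have := cone_seq_dist_triangle y x z; rewrite xy yz addr0.
Qed.

Canonical cone_equiv :=
  EquivRel cone_rel cone_rel_refl cone_rel_sym cone_rel_trans.

Definition cone : Type := {eq_quot cone_equiv}.
HB.instance Definition _ := Choice.on cone.
HB.instance Definition _ := EqQuotient.on cone.

Definition cone_class x : cone := \pi_cone x.

Definition cone_dist (p q : cone) : R := cone_seq_dist (repr p) (repr q).

Lemma cone_distE x y : cone_dist (cone_class x) (cone_class y) = cone_seq_dist x y.
Proof.
have reprP z : cone_seq_dist (repr (cone_class z)) z = 0.
  by apply/eqP; have /eqmodP := reprK (cone_class z).
have le x1 y1 x2 y2 : cone_seq_dist x1 x2 = 0 -> cone_seq_dist y1 y2 = 0 ->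
    cone_seq_dist x1 y1 <= cone_seq_dist x2 y2.
  move=> x0' y0'; apply: le_trans (cone_seq_dist_triangle x2 _ _) _.
  rewrite x0' add0r; apply: le_trans (cone_seq_dist_triangle y2 _ _) _.
  by rewrite [X in _ + X]cone_seq_dist_sym y0' addr0.
apply/eqP; rewrite eq_le /cone_dist !le //; first by rewrite cone_seq_dist_sym.
by rewrite cone_seq_dist_sym.
Qed.

Lemma cone_distxx p : cone_dist p p = 0.
Proof. exact: cone_seq_distxx. Qed.

Lemma cone_dist_positivity p q : cone_dist p q = 0 -> p = q.
Proof. by move=> /eqP pq; rewrite -[p]reprK -[q]reprK; exact/eqmodP. Qed.

Lemma cone_dist_sym p q : cone_dist p q = cone_dist q p.
Proof. exact: cone_seq_dist_sym. Qed.

Lemma cone_dist_triangle q p r : cone_dist p r <= cone_dist p q + cone_dist q r.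
Proof. exact: cone_seq_dist_triangle. Qed.

HB.instance Definition _ := isMetric.Build R cone cone_distxx
  cone_dist_positivity cone_dist_sym cone_dist_triangle.

End Cone.

(* The point of a singleton counts as a cut-point. *)
Definition cut_point (X : topologicalType) (p : X) : Prop :=
  ~ connected (~` [set p]) \/ [set: X] = [set p].

Section Thick.
Variables (R : realType) (G : groupType).
Implicit Types (H S T : set G) (HH : set (set G)) (M : R).

Definition finite_generating_set H S : Prop := finite_set S /\ gen S = H.

Definition unconstricted H : Prop :=
  infinite_set H /\
  exists S, finite_generating_set H S /\
    exists d : scaling R,
      forall p : cone (word_space1 R S) d, ~ cut_point p.

Definition finite_index H : Prop :=
  finite_set [set [set (g * h)%g | h in H] | g in [set: G]].

(* As all word metrics on a finitely generated group are bi-Lipschitz equivalent,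
   the choice of T is immaterial. *)
Definition undistorted H : Prop :=
  forall S, finite_generating_set H S ->
  exists T, finite_generating_set [set: G] T /\
  exists L : R, 0 < L /\ forall g h, H g -> H h ->
    (word_dist S g h)%:R <= L * (word_dist T g h)%:R /\
    (word_dist T g h)%:R <= L * (word_dist S g h)%:R.

Definition algebraic_network HH M : Prop :=
  [/\ 0 < M,
      [/\ finite_set HH, HH !=set0 & forall H, HH H -> is_subgroup H],
      forall H, HH H -> (exists S, finite_generating_set H S) /\ undistorted H,
      exists G1, [/\ is_subgroup G1, finite_index G1,
        exists T, finite_generating_set [set: G] T /\
          forall g, exists2 h, G1 h & (word_dist T g h)%:R < M &
        exists S, finite_generating_set G1 S /\ S `<=` \bigcup_(H in HH) H] &
      forall H H', HH H -> HH H' ->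
        exists (k : nat) (K : nat -> set G),
          [/\ K 0%N = H, K k = H',
              forall i, (i <= k)%N -> HH (K i) &
              forall i, (i < k)%N -> infinite_set (K i `&` K i.+1)]].

Definition algebraically_thick_order0 : Prop := unconstricted [set: G].

Definition algebraically_thick_order_le1 : Prop :=
  algebraically_thick_order0 \/
  exists (M : R) (HH : set (set G)),
    (forall H, HH H -> unconstricted H) /\ algebraic_network HH M.

End Thick.

(* Main.v *)
(* The network consists of the subgroups Z^2 = <s, t> generated by two commuting
   transvections s = (a |-> ab) and t = (c |-> cd), for the pairs of [good_pair] below.
   Their asymptotic cones are R^2 with the l^1 metric, where no point separates.  Up to
   finite index the transvections generate Aut(F_n), by Nielsen reduction, and two of
   them are always linked by a chain of good pairs as soon as n >= 3.

   For undistortedness, in Out(F_n) as well, take the exponent of the largest power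
   w^k, w nonempty, occurring as a subword of a reduced word: a transvection or a
   signed permutation of the generators lowers it by at most one, whereas s^p t^q sends
   the square of a fixed short word to a word all of whose conjugates contain b^p and
   d^q.  Hence a product of m generators representing s^p t^q has
   |p|, |q| <= m + constant, and passing to powers removes the constant. *)
Require Import Defs.
From HB Require Import structures.
From mathcomp Require Import all_boot all_order all_algebra.
From mathcomp Require Import all_classical all_reals all_analysis.
From mathcomp Require Import zify lra.

Set Implicit Arguments.
Unset Strict Implicit.
Unset Printing Implicit Defensive.

Import Order.TTheory GRing.Theory Num.Theory.
Import numFieldNormedType.Exports.

(** Everything about $\mathrm{Aut}(F_n)$ and $\mathrm{Out}(F_n)$ is proved once, for a surjective
    morphism [pi] defined on $\mathrm{Aut}(F_n)$ whose equal values come from automorphisms that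
    differ by a conjugation; the identity and [out_class] are the two instances. Such a [pi]
    determines the image of an element only up to conjugacy, so the exponent has to be read off in a
    way that conjugation cannot destroy. This is why the test element is squared: if [u ++ u ++ u]
    is reduced, conjugating $u^2$ can only rotate it or surround it, and a copy of $u$ always
    survives.

    Nielsen reduction has an obstacle of its own. Minimal total length bounds each cancellation by
    half of a word, and the image of a letter may still be consumed by its two neighbours, one half
    each. A second quantity, compared only when lengths agree, rules this out. A minimal
    automorphism then never shortens a word, so the preimage of a generator is a single letter. *)

(** * Free groups, their automorphisms and transvections *)

Section Letters.
Variable X : choiceType.
Local Open Scope group_scope.
Local Notation F := (free_group X).
Implicit Types (a b c x : letter X) (f g : F) (u v w : seq (letter X)).

Definition free_gen a : F := @FreeGroup X [:: a] isT.

Lemma inv_letter_neq a : inv_letter a != a.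
Proof. by case: a => x b; rewrite xpair_eqE eqxx /=; case: b. Qed.

Lemma inv_letter_inj : injective (@inv_letter X).
Proof. exact: inv_inj (@inv_letterK X). Qed.

Lemma idx_eq a b : (a.1 == b.1) = (a == b) || (a == inv_letter b).
Proof.
case: a b => x p [y q]; rewrite !xpair_eqE /=.
by case: eqP => //= _; case: p; case: q.
Qed.

Lemma free_wordM f g : free_word (f * g) = free_mul_word f g.
Proof. by []. Qed.

Lemma free_word_inj f g : free_word f = free_word g -> f = g.
Proof. exact: val_inj. Qed.

Lemma free_gen_inj : injective free_gen.
Proof. by move=> a b /(congr1 (@free_word X)) []. Qed.

Lemma free_genV a : free_gen (inv_letter a) = (free_gen a)^-1.
Proof. exact: free_word_inj. Qed.

Lemma free_push_reduced a w : reduced (a :: w) -> free_push a w = a :: w.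
Proof. by case: w => //= b w /andP[/negPf ->]. Qed.

Lemma reduced_cat u v : reduced (u ++ v) -> reduced u /\ reduced v.
Proof.
case: u => [|a u] //; rewrite /reduced /= cat_path => /andP[-> p]; split => //.
exact: path_sorted p.
Qed.

Lemma free_mul_word_cat u v : reduced (u ++ v) -> free_mul_word u v = u ++ v.
Proof.
elim: u => //= a u IH r; rewrite IH; last exact: path_sorted r.
exact: free_push_reduced.
Qed.

Lemma free_mul_word_catl u1 u2 v :
  free_mul_word (u1 ++ u2) v = free_mul_word u1 (free_mul_word u2 v).
Proof. by rewrite /free_mul_word foldr_cat. Qed.

Lemma free_word_prod w : reduced w -> free_word (\prod_(a <- w) free_gen a) = w.
Proof.
elim: w => [|a w IH] r; first by rewrite big_nil.
rewrite big_cons free_wordM IH; first exact: free_push_reduced.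
exact: path_sorted r.
Qed.

Lemma free_prodE f : f = \prod_(a <- free_word f) free_gen a.
Proof. apply: free_word_inj; rewrite free_word_prod //; exact: free_wordP. Qed.

Lemma free_ind (P : F -> Prop) :
  P 1 -> (forall a f, P f -> P (free_gen a * f)) -> forall f, P f.
Proof.
move=> P1 PM f; rewrite (free_prodE f); elim: (free_word f) => [|a w IH].
  by rewrite big_nil.
by rewrite big_cons; exact: PM.
Qed.

Lemma size_free_push a w : (size (free_push a w) <= (size w).+1)%N.
Proof. by case: w => [|b w] //=; case: ifP => //= _; rewrite ltnW. Qed.

Lemma size_freeM f g : (size (free_word (f * g)%g) <= size (free_word f) + size (free_word g))%N.
Proof.
rewrite free_wordM; elim: (free_word f) => //= a w IH.
exact: leq_trans (size_free_push _ _) _.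
Qed.

Section Lift.
Variables (G : groupType) (h : letter X -> G).
Hypothesis hV : forall a, h (inv_letter a) = (h a)^-1.

Definition free_lift (f : F) : G := \prod_(a <- free_word f) h a.

Lemma free_lift_gen a : free_lift (free_gen a) = h a.
Proof. by rewrite /free_lift big_seq1. Qed.

Lemma free_liftM : {morph free_lift : f g / f * g}.
Proof.
have pushE a w : \prod_(x <- free_push a w) h x = h a * \prod_(x <- w) h x.
  case: w => [|b w] /=; first by rewrite big_cons.
  case: eqP => [->|_]; last by rewrite !big_cons.
  by rewrite big_cons hV mulVKg.
move=> f g; rewrite /free_lift free_wordM.
elim: (free_word f) => [|a w IH] /=; first by rewrite big_nil mul1g.
by rewrite pushE IH big_cons mulgA.
Qed.
End Lift.

Lemma morph_group1 (G H : groupType) (f : G -> H) :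
  {morph f : x y / x * y} -> f 1 = 1.
Proof. by move=> fM; apply: (mulgI (f 1)); rewrite -fM !mulg1. Qed.

Lemma morph_groupV (G H : groupType) (f : G -> H) :
  {morph f : x y / x * y} -> {morph f : x / x^-1}.
Proof.
move=> fM x; apply: (mulgI (f x)).
by rewrite -fM !mulgV morph_group1.
Qed.

Lemma morph_group_prod (G H : groupType) (f : G -> H) (I : Type) (s : seq I) (e : I -> G) :
  {morph f : x y / x * y} -> f (\prod_(i <- s) e i) = \prod_(i <- s) f (e i).
Proof.
move=> fM; elim: s => [|a s IH]; first by rewrite !big_nil morph_group1.
by rewrite !big_cons fM IH.
Qed.

Lemma morph_groupX (G H : groupType) (f : G -> H) :
  {morph f : x y / x * y} -> forall n, {morph f : x / x ^+ n}.
Proof.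
move=> fM n x; elim: n => [|n IH]; first by rewrite !expg0 morph_group1.
by rewrite !expgS fM IH.
Qed.

Lemma free_morph_eq (G : groupType) (f g : F -> G) :
  {morph f : x y / x * y} -> {morph g : x y / x * y} ->
  (forall a, f (free_gen a) = g (free_gen a)) -> f =1 g.
Proof.
move=> fM gM e; elim/free_ind => [|a x IH]; first by rewrite !morph_group1.
by rewrite fM gM e IH.
Qed.

Lemma autM (f : Aut F) : {morph f : x y / x * y}.
Proof. by case: (autP f). Qed.

Lemma aut_inj (f : Aut F) : injective f.
Proof. by case: (autP f) => /bij_inj. Qed.

Lemma aut_mulE (f g : Aut F) (x : F) : (f * g) x = f (g x).
Proof. by []. Qed.

Lemma autKV (f : Aut F) (x : F) : f^-1 (f x) = x.
Proof. by rewrite -aut_mulE mulVg. Qed.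

Lemma autK (f : Aut F) (x : F) : f (f^-1 x) = x.
Proof. by rewrite -aut_mulE mulgV. Qed.

Lemma aut_eq_gen (f g : Aut F) : (forall a, f (free_gen a) = g (free_gen a)) -> f = g.
Proof. by move=> e; apply: aut_eqP; apply: free_morph_eq e; exact: autM. Qed.

Definition tau_img a b x : F :=
  if x == a then free_gen a * free_gen b
  else if x == inv_letter a then (free_gen b)^-1 * (free_gen a)^-1 else free_gen x.

Lemma tau_imgV a b x : tau_img a b (inv_letter x) = (tau_img a b x)^-1.
Proof.
rewrite /tau_img (inj_eq inv_letter_inj).
have [->|xa] := eqVneq x a; first by rewrite (negPf (inv_letter_neq a)) ?eqxx invgM.
have -> : (inv_letter x == a) = (x == inv_letter a).
  by rewrite -(inj_eq inv_letter_inj) inv_letterK.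
by case: ifP => _; rewrite ?invgM ?invgK ?free_genV.
Qed.

Definition tau_fun a b : F -> F := free_lift (tau_img a b).

Lemma tau_funM a b : {morph tau_fun a b : x y / x * y}.
Proof. apply: free_liftM; exact: tau_imgV. Qed.

Lemma tau_img_idx a b x : a.1 != x.1 -> tau_img a b x = free_gen x.
Proof. by rewrite eq_sym idx_eq negb_or /tau_img => /andP[/negPf -> /negPf ->]. Qed.

Lemma tau_funK a b : a.1 != b.1 -> cancel (tau_fun a b) (tau_fun a (inv_letter b)).
Proof.
move=> ab; have e : a.1 != (inv_letter b).1 by [].
suff : tau_fun a (inv_letter b) \o tau_fun a b =1 id by [].
apply: free_morph_eq => //; first by move=> x y /=; rewrite !tau_funM.
move=> x /=; rewrite {2}/tau_fun free_lift_gen /tau_img.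
have ta c : tau_fun a (inv_letter b) (free_gen c) = tau_img a (inv_letter b) c.
  exact: free_lift_gen.
case: eqP => [->|xa].
  by rewrite tau_funM !ta (tau_img_idx _ ab) /tau_img eqxx free_genV mulgVK.
case: eqP => [->|xA]; last by rewrite ta /tau_img; do 2!case: eqP => //.
rewrite -!free_genV tau_funM !ta (@tau_img_idx _ _ (inv_letter b)) //.
by rewrite /tau_img (negPf (inv_letter_neq a)) eqxx !free_genV invgK mulKg.
Qed.

Lemma tau_fun_aut a b : a.1 != b.1 -> is_automorphism (tau_fun a b).
Proof.
move=> ab; split; last exact: tau_funM.
exists (tau_fun a (inv_letter b)); first exact: tau_funK.
by move=> x; rewrite -{1}(inv_letterK b) tau_funK.
Qed.

(* [tau a b] is the transvection a |-> ab when a and b have distinct indices,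
   and a junk value (the identity) otherwise. *)
Definition tau a b : Aut F :=
  if pselect (is_automorphism (tau_fun a b)) is left p
  then MkAut (introT (asboolP _) p) else 1.

Lemma tauE a b : a.1 != b.1 -> tau a b = tau_fun a b :> (F -> F).
Proof. by move=> ab; rewrite /tau; case: pselect => // -[]; exact: tau_fun_aut. Qed.

Lemma tau_gen a b x : a.1 != b.1 -> tau a b (free_gen x) = tau_img a b x.
Proof. by move=> ab; rewrite tauE // /tau_fun free_lift_gen. Qed.

Lemma tau_self a b : a.1 != b.1 -> tau a b (free_gen a) = free_gen a * free_gen b.
Proof. by move=> ab; rewrite tau_gen // /tau_img eqxx. Qed.

Lemma tau_fix a b x : a.1 != b.1 -> x != a -> x != inv_letter a ->
  tau a b (free_gen x) = free_gen x.
Proof. by move=> ab /negPf xa /negPf xA; rewrite tau_gen // /tau_img xa xA. Qed.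

Lemma tau_idx a b x : a.1 != b.1 -> a.1 != x.1 -> tau a b (free_gen x) = free_gen x.
Proof. by move=> ab ax; rewrite tau_gen // tau_img_idx. Qed.

Lemma tauV a b : a.1 != b.1 -> (tau a b)^-1 = tau a (inv_letter b).
Proof.
move=> ab; apply: aut_eqP => x; apply: (aut_inj (f := tau a b)).
rewrite autK !tauE //.
by rewrite -{1}(inv_letterK b) tau_funK.
Qed.

Lemma aut_genV (f : Aut F) a : f (free_gen (inv_letter a)) = (f (free_gen a))^-1.
Proof. by rewrite free_genV (morph_groupV (autM f)). Qed.

(** The case [c = inv_letter a] is included: there [tau c d] multiplies the generator [a] on the
    left by the inverse of [d], and left and right multiplications commute. *)
Lemma tau_commute a b c d : a != c -> a.1 != b.1 -> a.1 != d.1 -> c.1 != b.1 ->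
  c.1 != d.1 -> commute (tau a b) (tau c d).
Proof.
move=> ac ab ad cb cd.
have H x y p q : x != y -> x.1 != p.1 -> x.1 != q.1 -> y.1 != p.1 -> y.1 != q.1 ->
    (tau x p * tau y q) (free_gen x) = (tau y q * tau x p) (free_gen x).
  move=> xy xp xq yp yq; rewrite !aut_mulE tau_self // autM (tau_idx yq yp).
  case: (eqVneq x (inv_letter y)) => [e|xy']; last first.
    by rewrite tau_fix // tau_self.
  have -> : tau y q (free_gen x) = (free_gen q)^-1 * free_gen x.
    by rewrite e aut_genV tau_self // invgM free_genV.
  by rewrite autM -free_genV tau_idx // tau_self // mulgA.
apply: aut_eq_gen => x.
have [->|xa] := eqVneq x a; first exact: H.
have [->|xa'] := eqVneq x (inv_letter a); first by rewrite !aut_genV H.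
have [->|xc] := eqVneq x c; first by rewrite H // eq_sym.
have [->|xc'] := eqVneq x (inv_letter c); first by rewrite !aut_genV H // eq_sym.
by rewrite !aut_mulE !(tau_fix ab, tau_fix cd).
Qed.

End Letters.

Lemma infinite_seq (T : Type) (e : nat -> T) (A : set T) :
  injective e -> (forall n, A (e n)) -> infinite_set A.
Proof.
move=> ei eA; apply/infiniteP.
have /card_le_trans : ([set: nat] #<= (e @` [set: nat])%classic)%card.
  by have /card_eqPle[] := @inj_card_eq _ _ setT e (in2W ei).
by apply; apply: subset_card_le => _ [n _ <-]; exact: eA.
Qed.

(** * Word norms and subgroups generated by two commuting elements *)

Section WordNorm.
Variable G : groupType.
Implicit Types (g : G) (S T : set G).
Local Open Scope group_scope.

Lemma gen_sub S g : S g -> gen S g.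
Proof.
move=> Sg; exists [:: g]; last by rewrite /word_val big_seq1.
by move=> x; rewrite inE => /eqP ->; left.
Qed.

Lemma word_norm_gen1 S g : S g -> (word_norm S g <= 1)%N.
Proof.
move=> Sg; have := @word_norm_le _ S [:: g]; rewrite /word_val big_seq1; apply.
by move=> x; rewrite inE => /eqP ->; left.
Qed.

Lemma gen_expg S g n : gen S g -> gen S (g ^+ n).
Proof.
have [S1 SM _] := gen_subgroup S.
by move=> Sg; elim: n => [|n IH]; rewrite ?expg0 // expgS; exact: SM.
Qed.

Lemma word_norm_expg S g n : gen S g -> (word_norm S (g ^+ n)%g <= n * word_norm S g)%N.
Proof.
move=> Sg; elim: n => [|n IH]; first by rewrite expg0 word_norm1.
rewrite expgS mulSn (leq_trans (word_normM Sg _)) ?leq_add2l //.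
exact: gen_expg.
Qed.

Lemma word_norm_mul_le S T N : (forall x, S x -> gen T x) ->
  (forall x, S x -> (word_norm T x <= N)%N) ->
  forall g, gen S g -> gen T g /\ (word_norm T g <= N * word_norm S g)%N.
Proof.
have [T1 TM TV] := gen_subgroup T.
move=> ST SN g /word_normP[w [Sw <- <-]]; elim: w Sw => [|x w IH] Sw.
  by rewrite /word_val big_nil word_norm1.
have [gx nx] : gen T x /\ (word_norm T x <= N)%N.
  have [Sx|Sx] := Sw x (mem_head _ _); first by split; [exact: ST|exact: SN].
  rewrite -(invgK x); split; first exact/TV/ST.
  by rewrite word_normV ?SN //; exact: ST.
have [|gw nw] := IH; first by move=> y yw; apply: Sw; rewrite inE yw orbT.
rewrite /word_val big_cons; split; first exact: TM.
by rewrite (leq_trans (word_normM gx gw)) //= mulnS leq_add.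
Qed.

Lemma finite_norm_bound S T : finite_set S -> exists N, forall x, S x -> (word_norm T x <= N)%N.
Proof.
move=> /finite_seqP[s ->]; exists (\max_(x <- s) word_norm T x)%N => x /= xs.
exact: leq_bigmax_seq.
Qed.

Definition zpow g (p : int) : G :=
  match p with Posz n => g ^+ n | Negz n => g ^- n.+1 end.

Lemma zpow_succ g p : zpow g (p + 1)%R = zpow g p * g.
Proof.
case: p => [n|n]; first by rewrite /= addn1 expgSr.
case: n => [|n]; first by rewrite /= expg1 mulVg expg0.
have -> : (Negz n.+1 + 1)%R = Negz n by lia.
by rewrite /= [in RHS]expgS invgM mulgVK.
Qed.

Lemma zpowD g p q : zpow g (p + q)%R = zpow g p * zpow g q.
Proof.
elim: q p => [|n IH|n IH] p; first by rewrite addr0 /= expg0 mulg1.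
  by rewrite -addn1 PoszD addrA !zpow_succ IH mulgA.
apply: (mulIg g); rewrite -mulgA -!zpow_succ.
have -> : (p + - n.+1%:Z + 1 = p + - n%:Z)%R by lia.
have -> : (- n.+1%:Z + 1 = - n%:Z)%R by lia.
exact: IH.
Qed.

Lemma commute_zpow g h p : commute g h -> commute g (zpow h p).
Proof.
move=> c; case: p => n /=; first exact: commuteX.
exact/commuteV/commuteX.
Qed.

Lemma zpow0 g : zpow g 0 = 1. Proof. by []. Qed.

Lemma zpow1 g : zpow g 1 = g. Proof. by rewrite /= expg1. Qed.

Lemma word_norm_zpow S g p : gen S g ->
  gen S (zpow g p) /\ (word_norm S (zpow g p) <= `|p|%N * word_norm S g)%N.
Proof.
have [_ _ SV] := gen_subgroup S.
move=> Sg; case: p => n; first by split; [exact: gen_expg | exact: word_norm_expg].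
split; first exact/SV/gen_expg.
rewrite [zpow _ _]/= word_normV; last exact: gen_expg.
exact: word_norm_expg.
Qed.

Definition zpow2 s t (p q : int) : G := zpow s p * zpow t q.

Section Rank2.
Variables s t : G.
Hypothesis st : commute s t.
Local Notation f := (zpow2 s t).

Lemma zpow2D p q p' q' : f (p + p')%R (q + q')%R = f p q * f p' q'.
Proof.
rewrite /zpow2 !zpowD -!mulgA; congr (_ * _); rewrite !mulgA; congr (_ * _).
by apply: commute_zpow; apply/commute_sym/commute_zpow/commute_sym.
Qed.

Lemma zpow2N p q : f (- p)%R (- q)%R = (f p q)^-1.
Proof. by apply: (mulgI (f p q)); rewrite -zpow2D !subrr mulgV /zpow2 !zpow0 mulg1. Qed.

Lemma zpow2_10 : f 1 0 = s. Proof. by rewrite /zpow2 zpow1 zpow0 mulg1. Qed.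
Lemma zpow2_01 : f 0 1 = t. Proof. by rewrite /zpow2 zpow1 zpow0 mul1g. Qed.

Lemma word_norm_zpow2 S p q : gen S s -> gen S t ->
  gen S (f p q) /\
  (word_norm S (f p q) <= `|p|%N * word_norm S s + `|q|%N * word_norm S t)%N.
Proof.
move=> Ss St; have [gs ns] := word_norm_zpow p Ss; have [gt nt] := word_norm_zpow q St.
have [_ SM _] := gen_subgroup S; split; first exact: SM.
exact: leq_trans (word_normM gs gt) (leq_add ns nt).
Qed.

Lemma gen_pair_zpow2 w : signed_word [set s; t] w ->
  exists p q, word_val w = f p q /\ (`|p|%N + `|q|%N <= size w)%N.
Proof.
elim: w => [|x w IH] Sw.
  by exists 0, 0; split => //; rewrite /word_val big_nil /zpow2 !zpow0 mulg1.
have [|p [q [wpq le]]] := IH; first by move=> y yw; apply: Sw; rewrite inE yw orbT.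
have key a b : x = f a b -> (`|a| + `|b| = 1)%N -> exists p q : int,
    word_val (x :: w) = f p q /\ (`|p| + `|q| <= size (x :: w))%N.
  move=> xab ab1; exists (a + p)%R, (b + q)%R; split; last by move=> /=; lia.
  by rewrite /word_val big_cons [X in _ * X]wpq zpow2D xab.
have [] := Sw x (mem_head _ _) => -[] e.
- by apply: (key (Posz 1) (Posz 0)); rewrite // zpow2_10 e.
- by apply: (key (Posz 0) (Posz 1)); rewrite // zpow2_01 e.
- by apply: (key (- Posz 1)%R (- Posz 0)%R); rewrite // zpow2N zpow2_10 -e invgK.
- by apply: (key (- Posz 0)%R (- Posz 1)%R); rewrite // zpow2N zpow2_01 -e invgK.
Qed.

Lemma gen_pairP g : gen [set s; t] g <-> exists p q, g = f p q.
Proof.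
split=> [[w /gen_pair_zpow2[p [q [-> _]]] <-]|[p [q ->]]]; first by exists p, q.
have [] := @word_norm_zpow2 [set s; t] p q; try exact: gen_sub (or_introl erefl).
  exact: gen_sub (or_intror erefl).
by [].
Qed.

Lemma finite_generating_pair : finite_generating_set (gen [set s; t]) [set s; t].
Proof. by split => //; exact: finite_set2. Qed.

Section Injective.
Hypothesis f_inj : forall p q, f p q = 1 -> p = 0%R /\ q = 0%R.

Lemma zpow2_inj p q p' q' : f p q = f p' q' -> p = p' /\ q = q'.
Proof.
move=> e; have := @f_inj (p - p')%R (q - q')%R.
by rewrite zpow2D zpow2N e mulgV => /(_ erefl)[]; lia.
Qed.

Lemma word_norm_pair p q : word_norm [set s; t] (f p q) = (`|p|%N + `|q|%N)%N.
Proof.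
have Ss : gen [set s; t] s by exact: gen_sub (or_introl erefl).
have St : gen [set s; t] t by exact: gen_sub (or_intror erefl).
apply/eqP; rewrite eqn_leq; apply/andP; split; last first.
  have [w [Sw wf <-]] := word_normP (proj1 (@word_norm_zpow2 _ p q Ss St)).
  have [p' [q' [e le]]] := gen_pair_zpow2 Sw.
  by have [-> ->] := zpow2_inj (etrans (esym wf) e).
have [_ /leq_trans] := @word_norm_zpow2 _ p q Ss St; apply.
by apply: leq_add; rewrite -[leqRHS]muln1 leq_mul2l word_norm_gen1 ?orbT //; [left|right].
Qed.

Lemma infinite_gen_pair : infinite_set (gen [set s; t]).
Proof.
apply: (@infinite_seq _ (fun n : nat => f (Posz n) 0)).
  by move=> m n /zpow2_inj[[]].
by move=> n; apply/gen_pairP; exists (Posz n), 0.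
Qed.

End Injective.

(** A linear lower bound for one word metric of [G] is enough: the opposite inequality holds for
    every finite generating set [S] of the subgroup, and changing [S] costs only a constant. *)
Lemma undistorted_pair (R : realType) T C : finite_generating_set [set: G] T ->
  (forall p q, (`|p|%N + `|q|%N <= C * word_norm T (f p q))%N) ->
  undistorted R (gen [set s; t]).
Proof.
move=> fT hC S [finS gS]; exists T; split=> //.
have gT g : gen T g by rewrite fT.2.
have [N SN] := finite_norm_bound T finS.
set K := maxn (word_norm S s) (word_norm S t).
(* [N] bounds the [T]-norm on [S] and gives one inequality; writing an element as $s^pt^q$ costs at
   most $K(|p|+|q|)$, hence at most $KC$ times its [T]-norm, which gives the other. The sum serves
   for both, and the successor makes it positive. *)
exists ((N + C * K).+1%:R)%R; split; first by rewrite ltr0n.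
have Ss : gen S s by rewrite gS; exact: gen_sub (or_introl erefl).
have St : gen S t by rewrite gS; exact: gen_sub (or_intror erefl).
have [_ SM SV] := gen_subgroup S.
move=> g h; rewrite -gS => Sg Sh; rewrite -!natrM !ler_nat /word_dist.
have : gen S (g^-1 * h) by apply: SM => //; exact: SV.
move: (g^-1 * h) => k Sk; split; last first.
  have [_ /leq_trans] := word_norm_mul_le (fun x _ => gT x) SN Sk; apply.
  by rewrite leq_mul2r; apply/orP; right; lia.
have := Sk; rewrite gS => /gen_pairP[p [q e]].
have [_ le] := word_norm_zpow2 p q Ss St; have := hC p q; rewrite -e in le *.
move=> le2; apply: leq_trans le _.
apply: (@leq_trans ((`|p| + `|q|) * K)).
  by rewrite mulnDl leq_add // leq_mul2l ?leq_maxl ?leq_maxr orbT.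
apply: (@leq_trans (C * word_norm T k * K)); first by rewrite leq_mul2r le2 orbT.
by rewrite mulnAC leq_mul2r; apply/orP; right; lia.
Qed.

End Rank2.
End WordNorm.

(** * The asymptotic cones of Z^2 *)

Section Scaling.
Variable R : realType.
Local Open Scope ring_scope.
Local Open Scope classical_set_scope.

Lemma scaling_exists : exists d : scaling R, True.
Proof.
have [w [wU ow]] := @ultraFilterLemma nat \oo _.
(* An ultrafilter finer than the filter of tails is non-principal; the shift to $n+1$ keeps the
   scaling positive at $n=0$. *)
unshelve eexists (@Scaling R w wU _ (fun n => n.+1%:R) _ _) => //.
- move=> n wn; have : w [set m | (n < m)%N] by apply: ow; exists n.+1.
  by move=> /(filterI wn)/filter_ex[m []/= ->]; rewrite ltnn.
- apply: cvg_trans (cvg_app _ ow) _; apply/cvgryPge => A.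
  exists (Num.bound `|A|) => // n /= An; apply: le_trans (ler_norm _) _.
  by rewrite ltW // (lt_le_trans (archi_boundP (normr_ge0 A))) // ler_nat; exact: leqW.
Qed.

Variable d : scaling R.
Local Notation w := (scale_ultra d).

Lemma inv_scale_cvg0 : (fun n => (d n)^-1) @ w --> (0 : R).
Proof.
apply/gtr0_cvgV0; last exact: scale_cvg.
by near=> n; exact: scale_gt0.
Unshelve. all: by end_near. Qed.

(** Realises an arbitrary real coordinate by integer points of the rescaled lattice. *)
Lemma floor_scale_cvg x : (fun n => (Num.floor (x * d n))%:~R / d n) @ w --> x.
Proof.
apply: (@squeeze_cvgr _ _ _ _ (fun n => x - (d n)^-1) (fun=> x)).
- near=> n; have /andP[le ge] := floor_itv (x * d n).
  have dn := scale_gt0 d n.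
  rewrite ler_pdivlMr // mulrBl mulVf ?gt_eqF // ler_pdivrMr // le andbT.
  move: ge; rewrite intrD mulr1z; lra.
- rewrite -[X in _ --> X]subr0; apply: cvgB; [exact: cvg_cst | exact: inv_scale_cvg0].
- exact: cvg_cst.
Unshelve. all: by end_near. Qed.

(** Compactness of a segment makes every bounded sequence converge along the ultrafilter; this
    supplies the two coordinates of a cone point. *)
Lemma bounded_ultra_cvg (u : nat -> R) C : (\forall n \near w, `|u n| <= C) ->
  exists l : R, u @ w --> l.
Proof.
move=> uC; have uf : UltraFilter (u @ w) by exact: ultra_fmap.
have := @segment_compact R (- C) C; rewrite compact_ultra => /(_ _ uf) [].
  suff : \forall n \near w, u n \in `[- C, C]%R by [].
  near=> n; rewrite in_itv /= -ler_norml; near: n; exact: uC.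
by move=> l [_ ul]; exists l.
Unshelve. all: by end_near. Qed.

Lemma cvg_norm_bounded (u : nat -> R) x : u @ w --> x ->
  \forall n \near w, `|u n| <= `|x| + 1.
Proof.
move=> ux; have /cvgrPdist_le/(_ 1 ltr01) := ux; apply: filterS => n le.
rewrite -[u n](subKr x); apply: le_trans (ler_normB _ _) _.
by rewrite lerD2l.
Qed.

End Scaling.

Section ConePlane.
Variables (R : realType) (G : groupType) (s t : G).
Hypothesis st : commute s t.
Hypothesis st_inj : forall p q, zpow2 s t p q = 1%g -> p = 0 /\ q = 0.
Local Notation S := [set s; t]%classic.
Local Notation T := (word_space R S).
Local Open Scope ring_scope.
Local Open Scope classical_set_scope.

Definition zpow2_space (p q : int) : T :=
  exist _ (zpow2 s t p q) (mem_set (proj2 (gen_pairP st _)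
    (ex_intro _ p (ex_intro _ q erefl)))).

Lemma zpow2_space_surj (x : T) : exists pq : int * int, x = zpow2_space pq.1 pq.2.
Proof.
have [p [q e]] := proj1 (gen_pairP st _) (word_space_valP x).
by exists (p, q); apply: val_inj.
Qed.

Lemma mdist_zpow2_space p q p' q' :
  mdist (zpow2_space p q) (zpow2_space p' q') =
  `|p%:~R - p'%:~R| + `|q%:~R - q'%:~R| :> R.
Proof.
have -> : mdist (zpow2_space p q) (zpow2_space p' q') =
  (word_norm S ((zpow2 s t p q)^-1 * zpow2 s t p' q')%g)%:R :> R by [].
rewrite -zpow2N // -zpow2D // word_norm_pair // natrD !natr_absz.
by rewrite -!intrB -!intr_norm; congr (_%:~R + _%:~R); lia.
Qed.

Variable d : scaling R.
Local Notation w := (scale_ultra d).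
Local Notation cone0 := (cone (word_space1 R S) d).

Lemma mdist_scaled p q p' q' n : mdist (zpow2_space p q) (zpow2_space p' q') / d n =
  `|p%:~R / d n - p'%:~R / d n| + `|q%:~R / d n - q'%:~R / d n|.
Proof.
rewrite mdist_zpow2_space mulrDl -!mulrBl !normrM.
by rewrite (gtr0_norm (x := (d n)^-1)) // invr_gt0 scale_gt0.
Qed.

Lemma word_space1E : word_space1 R S = zpow2_space 0 0.
Proof. by apply: val_inj; rewrite /= /zpow2 !zpow0 mulg1. Qed.

Definition plane_seq (x y : R) : nat -> T :=
  fun n => zpow2_space (Num.floor (x * d n)) (Num.floor (y * d n)).

Lemma plane_seq_bounded x y : cone_bounded (word_space1 R S) d (plane_seq x y).
Proof.
exists ((`|x| + 1) + (`|y| + 1)); near=> n.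
by rewrite word_space1E mdist_scaled !mul0r !sub0r !normrN lerD //; near: n;
  exact/cvg_norm_bounded/floor_scale_cvg.
Unshelve. all: by end_near. Qed.

Definition plane_pt (x y : R) : cone0 :=
  cone_class (ConeSeq (introT (asboolP _) (plane_seq_bounded x y))).

(** The second point is given by any representative with convergent rescaled coordinates, so the
    lemma yields both the metric on the plane and, at distance zero, the surjectivity of
    [plane_pt]. *)
Lemma plane_pt_dist x y (z : cone_seq (word_space1 R S) d) (p q : nat -> int) x' y' :
  (forall n, z n = zpow2_space (p n) (q n)) ->
  (fun n => (p n)%:~R / d n) @ w --> x' -> (fun n => (q n)%:~R / d n) @ w --> y' ->
  cone_dist (plane_pt x y) (cone_class z) = `|x - x'| + `|y - y'|.
Proof.
move=> ze px qy; rewrite /plane_pt cone_distE /cone_seq_dist.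
apply: cvg_lim => //; under eq_fun do rewrite ze mdist_scaled.
apply: cvgD; apply: cvg_norm; apply: cvgB => //; exact: floor_scale_cvg.
Qed.

Lemma plane_dist x y x' y' :
  cone_dist (plane_pt x y) (plane_pt x' y') = `|x - x'| + `|y - y'|.
Proof. by apply: plane_pt_dist => [//||]; exact: floor_scale_cvg. Qed.

Lemma plane_pt_surj (z : cone0) : exists x y, z = plane_pt x y.
Proof.
rewrite -[z]reprK; move: (repr z) => u.
have /choice[f fE] : forall n, exists pq : int * int, u n = zpow2_space pq.1 pq.2.
  by move=> n; exact: zpow2_space_surj.
have /asboolP[C uC] := cone_funP u.
have le n : `|(f n).1%:~R / d n| + `|(f n).2%:~R / d n| =
    mdist (word_space1 R S) (u n) / d n.
  by rewrite fE word_space1E mdist_scaled !mul0r !sub0r !normrN.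
have [x xP] : exists l : R, (fun n => (f n).1%:~R / d n) @ w --> l.
  apply: (@bounded_ultra_cvg _ _ _ C); near=> n.
  apply: (@le_trans _ _ (mdist (word_space1 R S) (u n) / d n)).
    by rewrite -le lerDl.
  by near: n.
have [y yP] : exists l : R, (fun n => (f n).2%:~R / d n) @ w --> l.
  apply: (@bounded_ultra_cvg _ _ _ C); near=> n.
  apply: (@le_trans _ _ (mdist (word_space1 R S) (u n) / d n)).
    by rewrite -le lerDr.
  by near: n.
exists x, y; apply/esym/cone_dist_positivity.
by rewrite (plane_pt_dist x y fE xP yP) !subrr normr0 addr0.
Unshelve. all: by end_near. Qed.

Lemma plane_pt_inj x y x' y' : plane_pt x y = plane_pt x' y' -> x = x' /\ y = y'.
Proof.
move=> e; have := plane_dist x y x' y'; rewrite e cone_distxx => /esym/eqP.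
by rewrite paddr_eq0 // !normr_eq0 !subr_eq0 => /andP[/eqP-> /eqP->].
Qed.

Lemma plane_line_connected (f : R -> cone0) :
  (forall x y, cone_dist (f x) (f y) <= `|x - y|) -> connected (f @` setT).
Proof.
move=> lip; apply: connected_continuous_connected.
  by apply/connected_intervalP => ?.
apply: continuous_subspaceT => x; apply/metricType_numDomainType.cvgrPdist_lt => e e0.
have /cvgrPdist_lt/(_ e e0) : y @[y --> x] --> x by exact: cvg_id.
by apply: filterS => y; apply: le_lt_trans; exact: lip.
Qed.

Definition vline x : set cone0 := [set plane_pt x y | y in setT].
Definition hline y : set cone0 := [set plane_pt x y | x in setT].

Lemma vline_connected x : connected (vline x).
Proof.
by apply: plane_line_connected => y y'; rewrite plane_dist subrr normr0 add0r.
Qed.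

Lemma hline_connected y : connected (hline y).
Proof.
by apply: plane_line_connected => x x'; rewrite plane_dist subrr normr0 addr0.
Qed.

Lemma plane_no_cut_point (p : cone0) : ~ cut_point p.
Proof.
have [x0 [y0 ->]] := plane_pt_surj p.
have x1 : x0 + 1 != x0 by rewrite -subr_eq0 addrC addKr oner_eq0.
have y1 : y0 + 1 != y0 by rewrite -subr_eq0 addrC addKr oner_eq0.
case=> [|e]; last first.
  have : [set plane_pt x0 y0] (plane_pt (x0 + 1) y0) by rewrite -e.
  by move=> /plane_pt_inj[/eqP]; rewrite (negPf x1).
apply.
(* For admissible [z], [D z] is the union of two crosses missing the removed point: a fixed one at
   $(x_0+1,y_0+1)$, common to all, and one at [z]. A point on the vertical line through the removed
   point is caught by the horizontal arm of the cross at $(x_0+1,y)$, any other one by the vertical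
   arm of the cross at $(x,y_0+1)$. *)
pose D (z : R * R) := (vline (x0 + 1) `|` hline (y0 + 1)) `|` (vline z.1 `|` hline z.2).
have -> : ~` [set plane_pt x0 y0] =
    \bigcup_(z in [set z : R * R | z.1 <> x0 /\ z.2 <> y0]) D z.
  apply/seteqP; split=> [z|z [[x y] /= [xx yy]]].
    have [x [y ->]] := plane_pt_surj z => /= ne.
    have [ex|nx] := eqVneq x x0.
      have ny : y <> y0 by move=> ey; apply: ne; rewrite ex ey.
      exists (x0 + 1, y); first by split; [exact/eqP|].
      by right; right; exists x.
    by exists (x, y0 + 1); [split; exact/eqP|right; left; exists y].
  by case=> -[[a _ <-]|[a _ <-]] /= /plane_pt_inj[] e1 e2;
    try (exact: xx); try (exact: yy); move/eqP: x1; move/eqP: y1.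
apply: bigcup_connected.
  exists (plane_pt (x0 + 1) (y0 + 1)) => z _; left; left.
  by exists (y0 + 1).
have cross x y : connected (vline x `|` hline y).
  apply: connectedU; [|exact: vline_connected|exact: hline_connected].
  by exists (plane_pt x y); split; [exists y | exists x].
move=> [x y] _; apply: connectedU; [|exact: cross|exact: cross].
by exists (plane_pt (x0 + 1) y); split; [left; exists y | right; exists (x0 + 1)].
Qed.


End ConePlane.

Lemma unconstricted_pair (R : realType) (G : groupType) (s t : G) : commute s t ->
  (forall p q, zpow2 s t p q = 1%g -> p = 0 /\ q = 0)%R ->
  unconstricted R (gen [set s; t]%classic).
Proof.
move=> st inj; split; first exact: infinite_gen_pair.
exists [set s; t]%classic; split; first exact: finite_generating_pair.
have [d _] := scaling_exists R; exists d => p.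
exact: plane_no_cut_point.
Qed.

(** * Periodic subwords and transvections *)

Section Powers.
Variable X : choiceType.
Implicit Types (a b c x y z : letter X) (u v w s : seq (letter X)) (f g : free_group X).

Lemma prodg_cat (G : groupType) (h : letter X -> G) u v :
  (\prod_(c <- u ++ v) h c = \prod_(c <- u) h c * \prod_(c <- v) h c)%g.
Proof. by rewrite big_cat. Qed.

Definition wpow (T : Type) (w : seq T) k := flatten (nseq k w).

Lemma wpowS (T : Type) (w : seq T) k : wpow w k.+1 = w ++ wpow w k.
Proof. by []. Qed.

Lemma size_wpow (T : Type) (w : seq T) k : size (wpow w k) = (k * size w)%N.
Proof. by elim: k => // k IH; rewrite wpowS size_cat IH mulSn. Qed.

Lemma flatten_wpow (T : Type) (w : seq (seq T)) k :
  flatten (wpow w k) = wpow (flatten w) k.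
Proof. by elim: k => // k IH; rewrite !wpowS flatten_cat IH. Qed.

Lemma map_wpow (T U : Type) (h : T -> U) (w : seq T) k : map h (wpow w k) = wpow (map h w) k.
Proof. by elim: k => // k IH; rewrite !wpowS map_cat IH. Qed.

(** The period [w] is left free because a transvection changes it and its length; only the number of
    repetitions is controlled. *)
Definition has_power k v := exists u1 w u2, w <> [::] /\ v = u1 ++ wpow w k ++ u2.

Lemma has_power_cat k u v w : has_power k v -> has_power k (u ++ v ++ w).
Proof.
move=> [u1 [p [u2 [p0 ->]]]]; exists (u ++ u1), p, (u2 ++ w).
by split=> //; rewrite -!catA.
Qed.

Lemma has_power_size k v : has_power k v -> (k <= size v)%N.
Proof.
move=> [u1 [w [u2 [/eqP w0 ->]]]]; rewrite !size_cat size_wpow.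
have : (0 < size w)%N by rewrite lt0n size_eq0.
by nia.
Qed.

Lemma has_power_nseq k x : has_power k (nseq k x).
Proof.
exists [::], [:: x], [::]; split=> //; rewrite cats0 /=.
by elim: k => //= k IH; rewrite wpowS /= -IH.
Qed.

(* [tau a b] acts on reduced words as a transducer: the reduced image of a word is
   obtained by outputting [tau_step a b x y] for each pair of consecutive letters. *)
Section Transducer.
Variables a b : letter X.
Hypothesis ab : a.1 != b.1.
Local Notation A := (inv_letter a).
Local Notation B := (inv_letter b).

(** The image of [x] is split as [tau_right x] followed by [tau_left x], a leading $b^{-1}$ going to
    the former. All cancellation then takes place inside the products of [tau_left x] with
    [tau_right y] for consecutive letters, and [tau_step x y] is such a product after
    cancellation. *)
Definition tau_left x := (if x == B then [::] else [:: x]) ++ (if x == a then [:: b] else [::]).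
Definition tau_right x := if (x == A) || (x == B) then [:: B] else [::].
Definition tau_step x y :=
  (if (x == B) || ((x == b) && (y == A)) then [::] else [:: x]) ++
  (if (x == a) && (y != B) then [:: b] else [::]) ++
  (if ((y == A) && (x != b)) || ((y == B) && (x != a)) then [:: B] else [::]).

Definition tau_tail x s := flatten (pairmap tau_step x s) ++ tau_left (last x s).

Local Notation eval u := (\prod_(c <- u) free_gen c)%g.

Let ab1 : a != b. Proof. by apply: contraNneq ab => ->. Qed.
Let aB1 : a != B. Proof. by apply: contraNneq ab => ->. Qed.
Let Ab1 : A != b. Proof. by apply: contraNneq ab => <-. Qed.
Let AB1 : A != B. Proof. by rewrite (inj_eq (@inv_letter_inj X)). Qed.
Let aA1 : a != A. Proof. by rewrite eq_sym inv_letter_neq. Qed.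
Let bB1 : b != B. Proof. by rewrite eq_sym inv_letter_neq. Qed.
Let neqs := (negPf ab1, negPf aB1, negPf Ab1, negPf AB1, negPf aA1, negPf bB1).
Let neqs' := (eq_sym b a, eq_sym B a, eq_sym b A, eq_sym B A, eq_sym A a, eq_sym B b).
Let E := (eqxx, neqs, neqs').

Lemma tau_leftright x : (eval (tau_right x) * eval (tau_left x))%g = tau a b (free_gen x).
Proof.
rewrite tau_gen // /tau_img /tau_left /tau_right big_cat /=.
have [->|xa] := eqVneq x a; first by rewrite !E /= !big_seq1 big_nil mul1g.
have [->|xA] := eqVneq x A.
  by rewrite !E /= !big_seq1 big_nil mulg1 !free_genV.
by have [->|xB] := eqVneq x B; rewrite /= ?E /= !(big_seq1, big_nil) ?mulg1 ?mul1g.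
Qed.

Lemma tau_stepE x y : y != inv_letter x ->
  eval (tau_step x y) = (eval (tau_left x) * eval (tau_right y))%g.
Proof.
rewrite /tau_step /tau_left /tau_right !big_cat /=.
have [->|xa] := eqVneq x a.
  rewrite !E /=; have [->|yB] := eqVneq y B.
    by rewrite !E /= !(big_seq1, big_nil) free_genV !mulg1 mulgK.
  by move=> /negPf ->; rewrite /= !(big_seq1, big_nil) !mulg1.
have [->|xB] := eqVneq x B.
  by rewrite !E /= !andbT !big_nil !mul1g.
have [->|xb] := eqVneq x b => /=; last first.
  by rewrite !andbT !big_nil !mulg1 mul1g.
move=> /negPf yB; rewrite yB /= andbF !orbF.
have [_|yA] := eqVneq y A; rewrite /= !(big_seq1, big_nil) ?mulg1 //.
by rewrite free_genV mulgV.
Qed.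

Lemma tau_tailE x s : reduced (x :: s) ->
  eval (tau_right x ++ tau_tail x s) = tau a b (eval (x :: s)).
Proof.
elim: s x => [|y s IH] x.
  by rewrite big_cat [LHS]tau_leftright big_seq1.
move=> /andP[yx r]; rewrite big_cons autM -IH // -tau_leftright.
have -> : tau_tail x (y :: s) = tau_step x y ++ tau_tail y s.
  by rewrite /tau_tail /= catA.
rewrite prodg_cat [eval (tau_step x y ++ _)]prodg_cat tau_stepE //.
by rewrite [eval (tau_right y ++ _)]prodg_cat !mulgA.
Qed.

(** The information on the first output letter that the induction needs in order to see that nothing
    cancels where a step meets the rest of the output. That output is empty only if [x] is
    $b^{-1}$. *)
Definition head_ok x s :=
  if s is z :: _ then
    if x == b then (z == b) || (z == A)
    else if x == B then (z != b) && (z != A) else z == x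
  else x == B.

Lemma tau_tail_reduced x s : reduced (x :: s) -> reduced (tau_tail x s) /\ head_ok x (tau_tail x s).
Proof.
elim: s x => [|y s IH] x.
  move=> _; rewrite /tau_tail /tau_left /=.
  have [->|xa] := eqVneq x a; first by rewrite ?E /= ?E.
  have [->|xB] := eqVneq x B; first by rewrite ?E /= ?E.
  by rewrite /= eqxx; case: eqVneq => [->|]; rewrite ?E //= ?(negPf xB) ?E.
move=> /andP[yx r]; have [{}IH hd] := IH y r.
have -> : tau_tail x (y :: s) = tau_step x y ++ tau_tail y s.
  by rewrite /tau_tail /= catA.
move: (tau_tail y s) IH hd => t rt hd.
have rc c : c != B -> c != a -> y != B -> y != inv_letter c -> reduced (c :: t).
  case: t rt hd => [|z t] //= rt hd cB ca yB yc; rewrite /reduced /= rt andbT.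
  move: hd; rewrite (negPf yB); case: eqVneq => [_|_ /eqP -> //].
  case/orP => /eqP ->; last by rewrite (inj_eq (@inv_letter_inj X)) eq_sym.
  by apply: contraNneq cB => ->; rewrite inv_letterK.
have rB : y = A \/ y = B -> reduced (B :: t).
  case: t rt hd {rc} => [|z t] //= rt hd yAB; rewrite /reduced /= rt andbT inv_letterK.
  by move: hd; case: yAB => ->; rewrite ?E; [move/eqP=> ->; rewrite E|case/andP].
rewrite /tau_step.
have [xB|xB] := eqVneq x B.
  rewrite xB ?E /= andbT.
  have [yA|yA] := eqVneq y A.
    by split; [exact: rB (or_introl yA)|rewrite /head_ok /= ?E].
  have [yB|yB] := eqVneq y B.
    by split; [exact: rB (or_intror yB)|rewrite /head_ok /= ?E].
  split=> //=; move: hd yx; rewrite xB inv_letterK /head_ok.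
  case: t {rt rc rB} => [|z t]; first by rewrite (negPf yB).
  by rewrite ?E (negPf yB) => + /negPf yb; rewrite yb => /eqP ->; rewrite yb yA.
have [xb|xb] := eqVneq x b.
  rewrite xb ?E /= andbF.
  have yB : y != B by rewrite -xb.
  have [yA|yA] := eqVneq y A.
    rewrite /= yA E /=; split=> //; move: hd; rewrite yA /head_ok ?E.
    by case: t {rt rc rB} => [|z t] //; rewrite ?eqxx => /eqP ->; rewrite ?E ?orbT.
  rewrite /= (negPf yB) /=; split; last by rewrite E.
  by apply: rc => //; rewrite eq_sym.
rewrite /= !andbT.
have [xa|xa] := eqVneq x a.
  have yA : y != A by rewrite -xa.
  rewrite (negPf yA) /= andbF /=.
  have [yB|yB] := eqVneq y B.
    rewrite /= xa; split; last by rewrite /head_ok ?E.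
    move: hd; rewrite yB /head_ok ?E /reduced.
    case: t rt {rc rB} => [|z t] //= rt /andP[zb zA].
    by rewrite zA.
  rewrite /= xa; split; last by rewrite /head_ok ?E.
  have := rc b; rewrite ?E => /(_ isT isT yB yB); by rewrite /reduced /= => ->.
rewrite /= andbT; split; last by rewrite (negPf xb) (negPf xB) eqxx.
have [yAB|] := boolP ((y == A) || (y == B)); last first.
  by rewrite negb_or => /andP[yA yB] /=; exact: rc.
have := rB; rewrite /reduced /= => -> //.
  by rewrite andbT (inj_eq (@inv_letter_inj X)) eq_sym.
by case/orP: yAB => /eqP; [left|right].
Qed.

Lemma tau_transducer x s : reduced (x :: s) ->
  free_word (tau a b (eval (x :: s))) = tau_right x ++ tau_tail x s.
Proof.
move=> r; rewrite -tau_tailE // free_word_prod //.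
have [] := tau_tail_reduced r; rewrite /tau_right; move: (tau_tail x s) => t rt.
case: eqVneq => [->|_] /=.
  case: t rt => [|z t] //= rt; rewrite /head_ok /= ?E //.
  by move=> /eqP zA; apply/andP; split=> //; rewrite zA inv_letterK ?E.
case: eqVneq => [->|_] //=.
case: t rt => [|z t] //= rt; rewrite /head_ok /= ?E // => /andP[zb _].
by apply/andP; split=> //; rewrite inv_letterK.
Qed.

(** A step can be empty only at $b$ or $b^{-1}$, and the letter that follows is then neither of the
    two, so it is output by the next step. *)
Lemma tau_step_nil x y z : y != inv_letter x -> tau_step x y = [::] ->
  [/\ x = b \/ x = B, y != b, y != B & tau_step y z <> [::]].
Proof.
move=> yx; rewrite /tau_step.
have [xB|xB] := eqVneq x B.
  rewrite xB ?E /= andbT; have [//|yA] := eqVneq y A; have [//|yB] := eqVneq y B.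
  move=> _; move: yx; rewrite xB inv_letterK => /negPf yb.
  by split; [right|rewrite yb|..]; rewrite // yb.
rewrite /=; have [xb|//] := eqVneq x b; have [->|//] := eqVneq y A.
by move=> _; rewrite ?E; split; [left|..].
Qed.

(** The image of a period must not vanish. Two consecutive empty steps are impossible, and a
    one-letter period would be its own successor. *)
Lemma pairmap_tau_step_neq0 l w : w <> [::] -> last l w = l -> reduced (l :: w) ->
  flatten (pairmap tau_step l w) <> [::].
Proof.
case: w => [//|y w] _ /= lw /andP[yl r].
case e: (tau_step l y) => [|//] /=.
case: w lw r => [/= yl' _|z w /= _ _].
  by have [[lb|lb] yb yB _] := tau_step_nil l yl e; move: yb yB; rewrite yl' lb eqxx.
by have [_ _ _] := tau_step_nil z yl e; case: (tau_step y z).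
Qed.

Lemma pairmap_wpow (T U : Type) (h : T -> T -> U) (l : T) (w : seq T) k : last l w = l ->
  pairmap h l (wpow w k) = wpow (pairmap h l w) k.
Proof. by move=> lw; elim: k => // k IH; rewrite !wpowS pairmap_cat lw IH. Qed.

(** Only the first copy of $w$ can be entered from a foreign letter. Every later copy is read after
    the last letter of $w$, so the transducer outputs the same block [c] for each of them, and at
    most one repetition is lost. For exponents 0 and 1 any nonempty word is a witness. *)
Lemma has_power_tau k f : has_power k (free_word f) ->
  has_power k.-1 (free_word (tau a b f)).
Proof.
case: k => [_|k]; first by exists [::], [:: a], (free_word (tau a b f)).
case: k => [_|k]; first by exists [::], [:: a], (free_word (tau a b f)).
move=> [u1 [w [u2 [w0 fE]]]] /=.
have rf := free_wordP f.
case uE: (u1 ++ w) => [|x s1]; first by case: (u1) uE w0 => //= ->.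
have ls : last x s1 = last x w.
  by rewrite -[LHS]/(last x (x :: s1)) -uE last_cat; case: (w) w0.
have lw : last (last x w) w = last x w by case: (w) w0.
have fE' : free_word f = x :: s1 ++ wpow w k.+1 ++ u2.
  by rewrite fE wpowS -!catA catA uE.
have r := rf; rewrite fE' in r.
set l := last x w in ls lw *; set c := flatten (pairmap tau_step l w).
have e : flatten (pairmap tau_step x (s1 ++ wpow w k.+1 ++ u2)) =
    flatten (pairmap tau_step x s1) ++ wpow c k.+1 ++ flatten (pairmap tau_step l u2).
  rewrite pairmap_cat flatten_cat ls; congr cat.
  rewrite pairmap_cat flatten_cat pairmap_wpow // flatten_wpow.
  congr (_ ++ flatten (pairmap _ _ _)).
  by elim: k {fE fE' r} => [|k IH]; rewrite wpowS last_cat lw.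
rewrite (free_prodE f) fE' tau_transducer // /tau_tail e.
eexists (_ ++ _), c, (_ ++ _); split; last by rewrite -!catA; reflexivity.
apply: pairmap_tau_step_neq0 => //.
have : reduced (l :: wpow w k.+1).
  move: r; rewrite -cat_cons lastI -/l ls cat_rcons => /reduced_cat[_].
  by rewrite -cat_cons => /reduced_cat[].
by rewrite wpowS -cat_cons => /reduced_cat[].
Qed.

End Transducer.

Local Open Scope group_scope.

(** For a finite alphabet these are the signed permutations of the basis. *)
Definition letter_aut (h : Aut (free_group X)) := forall a, exists b, h (free_gen a) = free_gen b.

Lemma has_power_letter_aut h k f : letter_aut h -> has_power k (free_word f) ->
  has_power k (free_word (h f)).
Proof.
move=> /choice[s hs] [u1 [w [u2 [w0 fE]]]].
have sI : injective s.
  by move=> x y e; apply/free_gen_inj/(aut_inj (f := h)); rewrite !hs e.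
have sV x : s (inv_letter x) = inv_letter (s x).
  by apply: free_gen_inj; rewrite free_genV -hs aut_genV hs.
have r : reduced (map s (free_word f)).
  rewrite /reduced sorted_map; apply: sub_sorted (free_wordP f) => x y /=.
  by rewrite -sV (inj_eq sI).
exists (map s u1), (map s w), (map s u2); split; first by case: (w) w0.
rewrite -map_wpow -!map_cat -fE [in LHS](free_prodE f) (morph_group_prod _ _ (autM h)).
under eq_bigr do rewrite hs.
by rewrite -(big_map s xpredT (fun x => free_gen x)) free_word_prod.
Qed.

Definition tau_set : set (Aut (free_group X)) :=
  [set g | exists a b, a.1 != b.1 /\ g = tau a b].
Definition tau_letter_set : set (Aut (free_group X)) := (tau_set `|` letter_aut)%classic.

End Powers.

Section FinitePowers.
Variable X : finType.
Local Open Scope group_scope.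
Implicit Types (f : free_group X) (m : seq (Aut (free_group X))).

Lemma letter_autV (h : Aut (free_group X)) : letter_aut h -> letter_aut h^-1.
Proof.
move=> /choice[s hs] a.
have sI : injective s.
  by move=> x y e; apply/free_gen_inj/(aut_inj (f := h)); rewrite !hs e.
by have [r _ sr] := injF_bij sI; exists (r a); rewrite -{1}(sr a) -hs autKV.
Qed.

(** Each factor, inverted or not, costs at most one repetition, the inverse of a transvection being
    a transvection. *)
Lemma has_power_word m k f : signed_word (@tau_letter_set X) m ->
  has_power (k + size m) (free_word f) -> has_power k (free_word (word_val m f)).
Proof.
elim: m k f => [|h m IH] k f Sm; first by rewrite addn0 /word_val big_nil.
rewrite /= addnS => pf.
have {}IH : has_power k.+1 (free_word (word_val m f)).
  apply: IH; last by rewrite addSn.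
  by move=> x xm; apply: Sm; rewrite inE xm orbT.
rewrite /word_val big_cons aut_mulE.
have loss g : tau_letter_set g -> has_power k (free_word (g (word_val m f))) /\
    has_power k (free_word (g^-1 (word_val m f))).
  have drop j v : has_power j.+1 v -> has_power j v.
    move=> [u1 [w [u2 [w0 ->]]]]; exists (u1 ++ w), w, u2; split=> //.
    by rewrite wpowS -!catA.
  case=> [[a [b [ab ->]]]|hg].
    by rewrite tauV //; split; rewrite -[k]/(k.+1.-1); apply: has_power_tau.
  by split; apply: drop; apply: has_power_letter_aut => //; exact: letter_autV.
have [/loss[]//|/loss[_]] := Sm h (mem_head _ _).
by rewrite invgK.
Qed.

End FinitePowers.

(** * Undistorted pairs of transvections *)

Section ConjugateSquare.
Variable X : choiceType.
Implicit Types (a b c d x y : letter X) (u v w r : seq (letter X)).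
Local Open Scope group_scope.
Local Notation eval u := (\prod_(c <- u) free_gen c).

Lemma eval_inv r : eval (free_inv_word r) = (eval r)^-1.
Proof.
elim: r => [|x r IH]; first by rewrite !big_nil invg1.
rewrite /free_inv_word /= rev_cons -cats1 prodg_cat big_seq1 big_cons invgM.
by rewrite -[X in X * _]/(eval (free_inv_word r)) IH free_genV.
Qed.

Lemma eval_nseq k x : eval (nseq k x) = free_gen x ^+ k.
Proof. by elim: k => [|k IH]; rewrite ?big_nil ?expg0 // big_cons expgS IH. Qed.

Lemma reduced_rcons_cat u x v : reduced (rcons u x) -> reduced (x :: v) -> reduced (rcons u x ++ v).
Proof.
case: u => [|y u] //= ru rv; rewrite /reduced /= cat_path last_rcons.
by apply/andP; split.
Qed.

Lemma reduced_conj x r v : v <> [::] -> reduced (x :: r) -> reduced v ->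
  head x v != x -> last x v != inv_letter x ->
  reduced (free_inv_word (x :: r) ++ v ++ x :: r).
Proof.
move=> v0 rr rv hv lv.
rewrite /free_inv_word /= rev_cons; apply: reduced_rcons_cat.
  by rewrite -rev_cons -[rev _]/(free_inv_word (x :: r)) reduced_inv.
rewrite -cat_cons; case/lastP: v v0 rv hv lv => [//|v y] _ rv hv lv.
rewrite -rcons_cons; apply: reduced_rcons_cat.
  by rewrite rcons_cons; case: (v) rv hv => [|z w] /= rv hv; rewrite /reduced /= ?rv inv_letterK hv.
apply/andP; split; last exact: rr.
move: lv; rewrite last_rcons; apply: contraNneq => ->; by rewrite inv_letterK.
Qed.

Section Rotations.
Variable u : seq (letter X).
Hypothesis ru : reduced (u ++ u ++ u).

Let is_rot v := exists p q, u = p ++ q /\ v = q ++ p.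

Let is_rot_left x v : is_rot (x :: v) -> is_rot (rcons v x).
Proof.
move=> [p [[|y q] [ue ve]]].
  by exists [:: x], v; rewrite cats1 ue cats0 -[p]cat0s -ve.
case: ve => -> ->; exists (rcons p y), q; by rewrite cat_rcons rcons_cat.
Qed.

Let is_rot_right x v : is_rot (rcons v x) -> is_rot (x :: v).
Proof.
move=> [p [q [ue ve]]]; case/lastP: p ue ve => [|p y] ue ve.
  by exists v, [:: x]; rewrite cats1 ue ve cats0.
have [-> ->] : v = q ++ p /\ x = y.
  by move: ve; rewrite -rcons_cat => /rcons_inj[].
by exists p, (y :: q); rewrite ue cat_rcons.
Qed.

(** Induction on the conjugator. If its first letter cancels against an end of $v^2$, the result is
    the square of a rotation of $v$, and a shorter conjugator remains; otherwise the product is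
    reduced as written. Allowing all rotations [v] of [u] is what lets the induction proceed. *)
Lemma conj_square_infix r : reduced r -> forall v, is_rot v ->
  exists s t, free_word ((eval r)^-1 * (eval v * eval v) * eval r) = s ++ u ++ t.
Proof.
(* For $u=pq$, the square $(qp)(qp)$ contains $pq$ and is itself a factor of $uuu$, hence
   reduced. *)
have rv2 v : is_rot v -> reduced (v ++ v) /\ exists s t, v ++ v = s ++ u ++ t.
  move=> [p [q [ue ->]]]; split; last by exists q, p; rewrite ue !catA.
  have := ru; rewrite ue.
  have -> : (p ++ q) ++ (p ++ q) ++ p ++ q = p ++ (((q ++ p) ++ (q ++ p)) ++ q) by rewrite !catA.
  by move=> /reduced_cat[_ /reduced_cat[]].
elim: r => [|x r IH] rr v rot.
  have [r2 [s [t e]]] := rv2 v rot; exists s, t.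
  by rewrite big_nil invg1 mul1g mulg1 -prodg_cat free_word_prod.
have {}IH := IH (proj2 (@reduced_cat _ [:: x] _ rr)).
have [r2 [s [t e]]] := rv2 v rot.
have cE : eval (x :: r) = free_gen x * eval r by rewrite big_cons.
case: (eqVneq (head x v) x) => [hx|hx].
  rewrite cE invgM.
  (* The default value of [head x v] sends the empty word to this branch, where conjugation by [x]
     changes nothing. *)
  case: v rot hx r2 e => [|y v] rot hx r2 e.
    have [|s' [t' e']] := IH [::]; first exact: rot.
    by move: e'; rewrite !big_nil !mulg1 => e'; exists s', t'; rewrite -e' mulgA mulgVK.
  rewrite /= in hx; move: rot; rewrite hx => /is_rot_left/IH[s' [t' e']].
  exists s', t'; rewrite -e'.
  rewrite big_cons -cats1 prodg_cat big_seq1; apply: (congr1 (@free_word X)).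
  by rewrite !mulgA mulgVK.
case: (eqVneq (last x v) (inv_letter x)) => [lx|lx].
  rewrite cE invgM.
  case/lastP: v rot lx hx r2 e => [|v y] rot lx hx r2 e; first by rewrite eqxx in hx.
  move: lx rot; rewrite last_rcons => -> /is_rot_right/IH[s' [t' e']].
  exists s', t'; rewrite -e'.
  rewrite -cats1 prodg_cat big_seq1 big_cons free_genV; apply: (congr1 (@free_word X)).
  by rewrite !mulgA mulgVK.
have v0 : v <> [::] by case: (v) hx => //=; rewrite eqxx.
exists (free_inv_word (x :: r) ++ s), (t ++ x :: r).
have -> : (free_inv_word (x :: r) ++ s) ++ u ++ (t ++ x :: r) =
   free_inv_word (x :: r) ++ (v ++ v) ++ x :: r by rewrite e -!catA.
rewrite -eval_inv -!prodg_cat -catA free_word_prod //.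
apply: reduced_conj => //; first by case: (v) v0.
  by case: (v) hx v0.
by rewrite last_cat; case: (v) v0 lx.
Qed.

End Rotations.

Lemma has_power_conj_square u g k : reduced (u ++ u ++ u) -> has_power k u ->
  has_power k (free_word ((eval u * eval u) ^ g)).
Proof.
move=> ru hu; have [] := conj_square_infix ru (free_wordP g) (v := u).
  by exists [::], u; rewrite cats0.
move=> s [t e]; rewrite /conjg (free_prodE g) mulgA -free_prodE.
by rewrite -(free_prodE g) in e; rewrite e; exact: has_power_cat.
Qed.

(** The first five conditions make the transvections commute. The last one concerns $c=a^{-1}$,
    where $a$ goes to $d^{-q}ab^p$: it prevents $b^p$ and $d^{-q}$ from cancelling in the square of
    this word. *)
Definition good_pair a b c d : bool :=
  [&& a != c, a.1 != b.1, a.1 != d.1, c.1 != b.1, c.1 != d.1 &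
      (a.1 == c.1) ==> (b.1 != d.1)].

Lemma good_pair_commute a b c d : good_pair a b c d -> commute (tau a b) (tau c d).
Proof. by case/and5P => ac ab ad cb /andP[cd _]; apply: tau_commute. Qed.

Lemma tauX_fix a b x k : a.1 != b.1 -> x != a -> x != inv_letter a ->
  (tau a b ^+ k) (free_gen x) = free_gen x.
Proof.
by move=> ab xa xA; elim: k => // k IH; rewrite expgSr aut_mulE tau_fix.
Qed.

Lemma tauX_self a b k : a.1 != b.1 -> (tau a b ^+ k) (free_gen a) = free_gen a * free_gen b ^+ k.
Proof.
move=> ab; elim: k => [|k IH]; first by rewrite expg0 mulg1.
rewrite expgSr aut_mulE tau_self // autM IH tauX_fix //; last 2 first.
- by apply: contraNneq ab => ->.
- by apply: contraNneq ab => ->.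
by rewrite -mulgA expgSr.
Qed.

Lemma idx_neq a x : a.1 != x.1 -> (x != a) /\ (x != inv_letter a).
Proof. by rewrite eq_sym idx_eq negb_or => /andP. Qed.

Definition compat x y := (x == y) || (x.1 != y.1).

Lemma compat_reduced v : sorted compat v -> reduced v.
Proof.
apply: sub_sorted => x y; rewrite /compat; apply: contraTneq => ->.
by rewrite /= eqxx orbF eq_sym inv_letter_neq.
Qed.

Lemma compat_idx x y : x.1 != y.1 -> compat x y /\ compat y x.
Proof. by rewrite /compat (eq_sym y.1) => ->; rewrite !orbT. Qed.

(** The block may be empty, so [v] has to fit after [x] as well as after [y]. *)
Lemma compat_path_nseq x y k v : compat x y -> path compat x v -> path compat y v ->
  path compat x (nseq k y ++ v).
Proof.
move=> xy xv yv; case: k => [|k] //=; rewrite xy /=.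
by elim: k => //= k ->; rewrite /compat eqxx.
Qed.

(** The test element is $a$, with image $d^{-q}ab^p$, when $c=a^{-1}$, and $ac$, with image
    $ab^pcd^q$, otherwise. Its length is bounded uniformly in $p$ and $q$, which makes the additive
    constant of the growth estimate independent of the exponents. *)
Lemma good_pair_test a b c d p q : good_pair a b c d ->
  exists f u, [/\ (size (free_word f) <= 2)%N,
    (tau a b ^+ p * tau c d ^+ q) f = eval u, reduced (u ++ u ++ u),
    has_power p u & has_power q u].
Proof.
case/and5P => ac ab ad cb /andP[cd /implyP bd].
case: (eqVneq a.1 c.1) => [e|ac1].
  have {ac}ca : c = inv_letter a.
    apply/eqP; have := idx_eq c a; rewrite e eqxx eq_sym (negPf ac) /=.
    by move=> <-.
  have bd' := bd (introT eqP e).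
  pose u := nseq q (inv_letter d) ++ a :: nseq p b.
  exists (free_gen a), u; split => //.
  - have ec : free_gen a = (free_gen c)^-1 by rewrite ca free_genV invgK.
    rewrite aut_mulE ec (morph_groupV (autM _)) tauX_self // invgM -ec -expVgn -free_genV.
    rewrite /u prodg_cat big_cons !eval_nseq autM.
    rewrite tauX_self // (morph_groupX (autM _)) tauX_fix //.
    + by have [] := idx_neq ad; rewrite (can2_eq (@inv_letterK X) (@inv_letterK X)).
    + by have [] := idx_neq ad; rewrite (inj_eq (@inv_letter_inj X)).
  - apply: compat_reduced.
    have [cad cda] := compat_idx (ad : a.1 != (inv_letter d).1).
    have [cbd _] := compat_idx (bd' : b.1 != (inv_letter d).1).
    have [cab cba] := compat_idx ab.
    have caa : compat a a by rewrite /compat eqxx.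
    have key x v : compat x a -> compat x (inv_letter d) -> path compat a v ->
        path compat b v -> path compat x (u ++ v).
      move=> xa xd av bv; rewrite /u -catA; apply: compat_path_nseq => //=.
        by rewrite xa; exact: compat_path_nseq.
      by rewrite cda; exact: compat_path_nseq.
    have -> : u ++ u ++ u = u ++ (u ++ (u ++ [::])) by rewrite cats0.
    by apply: (@path_sorted _ _ a); apply: (key) => //; apply: (key) => //; apply: (key).
  - rewrite /u -[_ :: _]cat1s catA -[X in has_power _ (_ ++ X)]cats0.
    exact/has_power_cat/has_power_nseq.
  - by rewrite /u -[X in has_power _ X]cat0s; exact/has_power_cat/has_power_nseq.
pose u := a :: nseq p b ++ c :: nseq q d.
exists (free_gen a * free_gen c), u; split => //.
- exact: leq_trans (size_freeM _ _) _.
- have [ca1 ca2] := idx_neq ac1; have [da1 da2] := idx_neq ad.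
  have [ac2 ac3] : (a != c) /\ (a != inv_letter c) by apply: idx_neq; rewrite eq_sym.
  rewrite aut_mulE autM tauX_fix // tauX_self // !autM tauX_self // tauX_fix //.
  rewrite (morph_groupX (autM _)) tauX_fix //.
  by rewrite /u big_cons prodg_cat big_cons !eval_nseq !mulgA.
- apply: compat_reduced.
  have [cac cca] := compat_idx ac1; have [cab _] := compat_idx ab.
  have [cad cda] := compat_idx ad; have [_ cbc] := compat_idx cb.
  have [ccd cdc] := compat_idx cd.
  have key x v : compat x a -> path compat c v -> path compat d v -> path compat x (u ++ v).
    move=> xa cv dv; rewrite /u /= xa -catA; apply: compat_path_nseq => //=.
      by rewrite cac; exact: compat_path_nseq.
    by rewrite cbc; exact: compat_path_nseq.
  have -> : u ++ u ++ u = u ++ (u ++ (u ++ [::])) by rewrite cats0.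
  by apply: (@path_sorted _ _ c); apply: (key) => //; apply: (key) => //; apply: (key).
- rewrite /u -cat1s; exact/has_power_cat/has_power_nseq.
- rewrite /u -[_ ++ _ :: _]cat_rcons -cat_cons -[X in has_power _ (_ ++ X)]cats0.
  exact/has_power_cat/has_power_nseq.
Qed.

End ConjugateSquare.

Section Growth.
Variables (X : finType) (G : groupType) (pi : Aut (free_group X) -> G).
Local Open Scope group_scope.
Local Notation T := (@tau_letter_set X).
Implicit Types (a b c d : letter X).
Hypothesis piM : {morph pi : x y / x * y}.
Hypothesis pi_inner : forall f h, pi f = pi h -> exists g, forall z, f z = (h z) ^ g.

Lemma good_pair_growth a b c d p q m : good_pair a b c d -> signed_word T m ->
  pi (word_val m) = pi (tau a b ^+ p * tau c d ^+ q) ->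
  (p <= size m + 4)%N /\ (q <= size m + 4)%N.
Proof.
move=> gp Sm /pi_inner[g hg].
have [f [u [sf fu ru pu qu]]] := good_pair_test p q gp.
have hf : word_val m (f * f) = (\prod_(x <- u) free_gen x * \prod_(x <- u) free_gen x) ^ g.
  by rewrite hg autM fu.
have key k : has_power k u -> (k <= size m + 4)%N.
  move=> ku; have := has_power_conj_square g ru ku; rewrite -hf => hk.
  case: (leqP k (size m)) => [km|mk]; first exact: leq_trans km (leq_addr _ _).
  (* Only losses of exponent are controlled, so the inverse word is applied to the image: it returns
     to [f * f], which has at most four letters, with at least [k - size m] repetitions left. *)
  have Sm' := signed_word_inv Sm; set m' := rev _ in Sm'.
  have szm : size m' = size m by rewrite size_rev size_map.
  have : has_power (k - size m) (free_word (f * f)).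
    rewrite -[f * f](autKV (word_val m)) -word_val_inv -/m'.
    by apply: has_power_word Sm' _; rewrite szm subnK // ltnW.
  move=> /has_power_size; have := size_freeM f f; lia.
by split; exact: key.
Qed.

(** A negative exponent is absorbed by inverting [b]; being a good pair depends on the multipliers
    only through their indices. *)
Lemma zpow_tau a b p : a.1 != b.1 -> exists b', b'.1 = b.1 /\ zpow (tau a b) p = tau a b' ^+ `|p|%N.
Proof.
move=> ab; case: p => n; first by exists b.
by exists (inv_letter b); split => //; rewrite -tauV // expVgn.
Qed.

Lemma good_pair_linear a b c d p q m : good_pair a b c d -> signed_word T m ->
  pi (word_val m) = pi (zpow2 (tau a b) (tau c d) p q) ->
  (`|p|%N + `|q|%N <= 2 * size m)%N.
Proof.
move=> gp Sm e; have := gp; case/and5P => ac ab ad cb /andP[cd bd].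
have [b' [eb pb]] := zpow_tau p ab; have [d' [ed pd]] := zpow_tau q cd.
have gp' : good_pair a b' c d' by rewrite /good_pair eb ed.
move: e; rewrite /zpow2 pb pd; move: `|p|%N `|q|%N => {pb pd}p {}q e.
have Smn n : signed_word T (flatten (nseq n m)).
  by elim: n => //= n IH; exact: signed_word_cat.
have val n : word_val (flatten (nseq n m)) = word_val m ^+ n.
  by elim: n => [|n IH]; rewrite /= ?expg0 /word_val ?big_nil // big_cat expgS /= -IH.
(* Five exceeds the additive constant 4: $5p\le 5|m|+4$ forces $p\le|m|$ for integers, and likewise
   for $q$. *)
have := @good_pair_growth a b' c d' (p * 5) (q * 5) _ gp' (Smn 5%N).
rewrite val size_flatten /shape map_nseq sumn_nseq !expgnA -expgMn; last first.
  exact/commuteX/commute_sym/commuteX/commute_sym/good_pair_commute.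
rewrite !(morph_groupX piM) e => /(_ erefl)[]; lia.
Qed.

End Growth.

(** * Nielsen reduction *)

Section CommonPrefix.
Variable X : choiceType.
Implicit Types (x y : letter X) (u v w : seq (letter X)).

(** The length of the longest common prefix, which is the number of letters that each factor loses
    in $u^{-1}v$. *)
Fixpoint lcp u v : nat :=
  match u, v with
  | x :: u', y :: v' => if x == y then (lcp u' v').+1 else 0
  | _, _ => 0
  end.

Lemma lcp_le u v : (lcp u v <= size u)%N /\ (lcp u v <= size v)%N.
Proof.
elim: u v => [|x u IH] [|y v] //=; case: eqP => //= _.
by have [] := IH v.
Qed.

Lemma lcpC u v : lcp u v = lcp v u.
Proof. by elim: u v => [|x u IH] [|y v] //=; rewrite eq_sym IH. Qed.

Lemma take_lcp u v : take (lcp u v) u = take (lcp u v) v.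
Proof. by elim: u v => [|x u IH] [|y v] //=; case: eqP => //= ->; rewrite IH. Qed.

Lemma lcp_nth x0 u v i : (i < lcp u v)%N -> nth x0 u i = nth x0 v i.
Proof.
elim: u v i => [|x u IH] [|y v] //= i; case: eqP => //= ->.
by case: i => //= i /IH.
Qed.

Lemma lcpxx u : lcp u u = size u.
Proof. by elim: u => //= x u ->; rewrite eqxx. Qed.

Lemma lcp_take_eq u v v' n : (lcp u v < n)%N -> take n v = take n v' -> lcp u v' = lcp u v.
Proof.
elim: u v v' n => [|x u IH] v v' [|n] //=.
case: v v' => [|y v] [|y' v'] //= h [<-]; case: eqVneq h => //= _ h e.
by rewrite (IH v v' n).
Qed.

Lemma free_mulV_lcp u v : reduced u -> reduced v ->
  free_mul_word (free_inv_word u) v =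
  free_inv_word (drop (lcp u v) u) ++ drop (lcp u v) v.
Proof.
elim: u v => [|x u IH] v ru rv; first by rewrite /= drop0.
have invE : free_inv_word (x :: u) = rcons (free_inv_word u) (inv_letter x).
  by rewrite /free_inv_word /= rev_cons.
have [ux rev] : reduced u /\ reduced (free_inv_word (x :: u)).
  by split; [exact: path_sorted ru | exact: reduced_inv].
case: v rv => [|y v] rv; first by rewrite free_mul_word1 //= cats0.
rewrite [lcp _ _]/=; case: eqVneq => [<-|xy].
  rewrite -IH //; last exact: path_sorted rv.
  by rewrite invE -cats1 free_mul_word_catl /= inv_letterK eqxx.
rewrite !drop0 free_mul_word_cat // invE; apply: reduced_rcons_cat; first by rewrite -invE.
by apply/andP; split=> //; rewrite inv_letterK eq_sym.
Qed.

Lemma size_free_inv_word u : size (free_inv_word u) = size u.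
Proof. by rewrite size_rev size_map. Qed.

Lemma size_free_mulV u v : reduced u -> reduced v ->
  (size (free_mul_word (free_inv_word u) v) + 2 * lcp u v = size u + size v)%N.
Proof.
move=> ru rv; rewrite free_mulV_lcp // size_cat size_free_inv_word !size_drop.
have [] := lcp_le u v; lia.
Qed.

Lemma free_inv_word_drop n u :
  free_inv_word (drop n u) = take (size u - n) (free_inv_word u).
Proof. by rewrite /free_inv_word map_drop rev_drop size_map. Qed.

(** If $w$ and $w^{-1}$ agreed on half of their length, the middle letter of $w$ would be its own
    inverse, or its two middle letters would cancel. *)
Lemma lcp_inv w : reduced w -> w <> [::] -> (2 * lcp w (free_inv_word w) < size w)%N.
Proof.
case: w => // x0 w' rw _; set w := x0 :: w' in rw *; rewrite ltnNge; apply/negP => le.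
have sz : (0 < size w)%N by [].
have key i : (i < lcp w (free_inv_word w))%N ->
    nth x0 w i = inv_letter (nth x0 w (size w - i.+1)).
  move=> il; have iw : (i < size w)%N by have [h _] := lcp_le w (free_inv_word w); lia.
  rewrite (lcp_nth x0 il) /free_inv_word nth_rev size_map //.
  by rewrite (nth_map x0) //; lia.
move: sz le rw key; move: w => w sz le rw key.
have [odd_w|even_w] := boolP (odd (size w)).
  have := key (size w)./2; have -> : (size w - (size w)./2.+1 = (size w)./2)%N by lia.
  have hlt : ((size w)./2 < lcp w (free_inv_word w))%N by lia.
  by move=> /(_ hlt)/esym/eqP; rewrite (negPf (inv_letter_neq _)).
have h0 : (0 < (size w)./2)%N by lia.
have := key (size w)./2.-1; have -> : (size w - (size w)./2.-1.+1 = (size w)./2)%N by lia.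
have hlt : ((size w)./2.-1 < lcp w (free_inv_word w))%N by lia.
move=> /(_ hlt) e; move: rw => /(sortedP x0)/(_ (size w)./2.-1).
by rewrite prednK // e inv_letterK eqxx => /(_ ltac:(lia)).
Qed.

End CommonPrefix.

Section Code.
Variable X : finType.
Implicit Types (x : letter X) (u v w : seq (letter X)).
Local Notation N := #|{: letter X}|.

(** Reads a word as a numeral in base [N], first letter least significant: words of equal length are
    separated, and exchanging a prefix for one of equal length changes the code by the difference of
    the prefix codes. *)
Fixpoint word_code w : nat :=
  if w is x :: w' then (enum_rank x + N * word_code w')%N else 0%N.

Lemma word_code_cat u v : word_code (u ++ v) = (word_code u + N ^ size u * word_code v)%N.
Proof.
elim: u => [|x u IH] /=; first by rewrite mul1n.
by rewrite IH mulnDr addnA expnS mulnA.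
Qed.

Lemma word_code_inj u v : size u = size v -> word_code u = word_code v -> u = v.
Proof.
elim: u v => [|x u IH] [|y v] //= [s] e.
have xy : enum_rank x = enum_rank y.
  apply: val_inj => /=; have := congr1 (modn^~ N) e.
  by rewrite /= ![(enum_rank _ + _)%N]addnC ![(N * _)%N]mulnC !modnMDl !modn_small.
move: e; rewrite xy (enum_rank_inj xy) => /addnI/eqP; rewrite eqn_mul2l.
case/orP => [/eqP N0|/eqP/IH->//].
by have := ltn_ord (enum_rank y); rewrite [X in (_ < X)%N]N0.
Qed.

End Code.

Section Nielsen.
Variable X : finType.
Local Open Scope group_scope.
Implicit Types (phi psi : Aut (free_group X)) (a b u v w x y : letter X) (s : seq (letter X)).
Local Notation eval s := (\prod_(c <- s) free_gen c).
Local Notation img phi x := (free_word (phi (free_gen x))).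

Definition aut_len phi := (\sum_(x : letter X) size (img phi x))%N.

(* Only the first half of the image of x is encoded: this makes the substitution of a
   half of a word for the inverse of the other half visible on one letter of x, x^-1. *)
Definition aut_code phi :=
  (\sum_(x : letter X) word_code (take (size (img phi x))./2 (img phi x)))%N.

(** The factor [tau x b] multiplies the image of [x] on the right by that of [b] and affects no
    other letter except the inverse of [x], so this is a lexicographic local minimum under
    elementary Nielsen moves. *)
Definition nielsen_minimal phi := forall x b, x.1 != b.1 ->
  (aut_len phi <= aut_len (phi * tau x b)%g)%N /\
  (aut_len (phi * tau x b)%g = aut_len phi -> (aut_code phi <= aut_code (phi * tau x b)%g)%N).

Lemma nielsen_minimal_exists phi :
  exists m, signed_word (@tau_set X) m /\ nielsen_minimal (phi * word_val m).
Proof.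
move: {2}(aut_len phi) (leqnn (aut_len phi)) => n.
elim/ltn_ind: n phi => n IHn phi; move: {2}(aut_code phi) (leqnn (aut_code phi)) => k.
elim/ltn_ind: k phi => k IHk phi lek len.
case: (pselect (nielsen_minimal phi)) => [mphi|nphi].
  by exists [::]; rewrite /word_val big_nil mulg1.
have [x [b [xb bad]]] : exists x b, x.1 != b.1 /\
    ((aut_len (phi * tau x b)%g < aut_len phi)%N \/
     aut_len (phi * tau x b)%g = aut_len phi /\ (aut_code (phi * tau x b)%g < aut_code phi)%N).
  apply: contrapT => H; apply: nphi => x b xb; split.
    by rewrite leqNgt; apply/negP => h; apply: H; exists x, b; split=> //; left.
  by move=> e; rewrite leqNgt; apply/negP => h; apply: H; exists x, b; split=> //; right.
have [m [Sm mm]] : exists m, signed_word (@tau_set X) m /\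
    nielsen_minimal (phi * tau x b * word_val m).
  case: bad => [lt_len|[e lt_code]].
    by apply: (IHn _ _ _ (leqnn _)); exact: leq_trans lt_len len.
  apply: (IHk _ _ _ (leqnn _)); last by rewrite e.
  exact: leq_trans lt_code lek.
exists (tau x b :: m); split; last by rewrite /word_val big_cons mulgA.
move=> y; rewrite inE => /orP[/eqP ->|]; last exact: Sm.
by left; exists x, b.
Qed.

Lemma img_inv phi x : img phi (inv_letter x) = free_inv_word (img phi x).
Proof. by rewrite aut_genV. Qed.

Lemma size_img_inv phi x : size (img phi (inv_letter x)) = size (img phi x).
Proof. by rewrite img_inv size_free_inv_word. Qed.

Lemma img_neq0 phi x : img phi x <> [::].
Proof.
move=> e; have : phi (free_gen x) = 1 by apply: free_word_inj.
rewrite -(morph_group1 (autM phi)) => /aut_inj /(congr1 (@free_word X)).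
by [].
Qed.

Lemma sum_two_letters (F H : letter X -> nat) x :
  (forall y, y != x -> y != inv_letter x -> F y = H y) ->
  (\sum_y F y + (H x + H (inv_letter x)) = \sum_y H y + (F x + F (inv_letter x)))%N.
Proof.
move=> FH; have ix := inv_letter_neq x.
have split2 E : (\sum_y E y =
    E x + E (inv_letter x) + \sum_(y | (y != x) && (y != inv_letter x)) E y)%N.
  by rewrite (bigD1 x) //= (bigD1 (inv_letter x)) //= addnA.
rewrite !split2 (eq_bigr H) => [|y /andP[yx yx']]; last exact: FH.
move: (\sum_(y | _) H y)%N (F x) (F _) (H x) (H _) => *; lia.
Qed.

Lemma img_tau_other phi x b y : x.1 != b.1 -> y != x -> y != inv_letter x ->
  img (phi * tau x b) y = img phi y.
Proof. by move=> xb yx yx'; rewrite aut_mulE tau_fix. Qed.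

(** Nielsen moves are used in this form, $a\mapsto b^{-1}a$, because the cancellation is then the
    common prefix of the images of $a$ and $b$. *)
Lemma img_tau_inv phi a b : a.1 != b.1 ->
  img (phi * tau (inv_letter a) b) a = free_mul_word (img phi (inv_letter b)) (img phi a).
Proof.
move=> ab; rewrite aut_mulE -{2}(inv_letterK a) aut_genV tau_self // invgM -!free_genV inv_letterK.
by rewrite autM.
Qed.

Section Minimal.
Variable phi : Aut (free_group X).
Hypothesis mphi : nielsen_minimal phi.
Local Notation A x := (img phi x).

Let rA x : reduced (A x). Proof. exact: free_wordP. Qed.

Lemma size_img_tau_inv a b : a.1 != b.1 ->
  (size (img (phi * tau (inv_letter a) b)%g a) + 2 * lcp (A b) (A a) =
   size (A b) + size (A a))%N.
Proof. by move=> ab; rewrite img_tau_inv // img_inv size_free_mulV. Qed.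

Lemma aut_len_tau_inv a b : a.1 != b.1 ->
  (aut_len (phi * tau (inv_letter a) b)%g + 2 * size (A a) =
   aut_len phi + 2 * size (img (phi * tau (inv_letter a) b)%g a))%N.
Proof.
move=> ab; have := @sum_two_letters (fun y => size (img (phi * tau (inv_letter a) b)%g y))
  (fun y => size (A y)) (inv_letter a)
  (fun y ya ya' => congr1 size (@img_tau_other phi (inv_letter a) b y ab ya ya')).
rewrite !inv_letterK !size_img_inv -/(aut_len _) -/(aut_len _).
by move: (aut_len _) (aut_len _) => *; lia.
Qed.

(** If more than half of the image of $b$ cancelled, the move $a\mapsto b^{-1}a$ would shorten the
    image of $a$. The pair $b=a^{-1}$, which admits no such move, is settled by [lcp_inv]. *)
Lemma nielsen1 a b : a != b -> (2 * lcp (A a) (A b) <= size (A b))%N.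
Proof.
move=> neq; case: (eqVneq a.1 b.1) => [/eqP|ab].
  rewrite idx_eq (negPf neq) /= => /eqP ->.
  by rewrite img_inv lcpC ltnW // lcp_inv // => /img_neq0.
have [le _] := @mphi (inv_letter a) b ab.
by have := aut_len_tau_inv ab; have := size_img_tau_inv ab; rewrite lcpC; lia.
Qed.

(** The move $u\mapsto v^{-1}u$ replaces the prefix $p$ by $q^{-1}$, of the same length. Total
    length is preserved, so minimality compares the codes. *)
Lemma nielsen2_half u v p q t : u.1 != v.1 -> A v = p ++ q -> A u = p ++ t ->
  size p = size q -> lcp (A v) (A u) = size p ->
  (word_code p <= word_code (free_inv_word q))%N.
Proof.
move=> uv Av Au pq lp.
have le2 : (2 * size p <= size (A u))%N.
  by rewrite -lp; apply: nielsen1; apply: contraNneq uv => ->.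
set psi := phi * tau (inv_letter u) v.
have psiu : img psi u = free_inv_word q ++ t.
  rewrite /psi img_tau_inv // img_inv free_mulV_lcp //.
  by rewrite lp Av Au !drop_size_cat.
have szu : size (img psi u) = size (A u).
  by rewrite psiu Au !size_cat size_free_inv_word pq.
have [_ min] := @mphi (inv_letter u) v uv.
have {min} : (aut_code phi <= aut_code psi)%N.
  by apply: min; have := aut_len_tau_inv uv; rewrite -/psi szu; lia.
have := @sum_two_letters (fun y => word_code (take (size (img psi y))./2 (img psi y)))
  (fun y => word_code (take (size (A y))./2 (A y))) (inv_letter u)
  (fun y ya ya' => congr1 (fun z => word_code (take (size z)./2 z))
    (@img_tau_other phi (inv_letter u) v y uv ya ya')).
rewrite -/(aut_code phi) -/(aut_code psi) inv_letterK !size_img_inv !szu.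
(* The image of $u^{-1}$ changes only at its end, beyond the half that is encoded, because
   $2|p|\le|\phi(u)|$. *)
have -> : take (size (A u))./2 (img psi (inv_letter u)) =
          take (size (A u))./2 (A (inv_letter u)).
  rewrite !img_inv psiu Au /free_inv_word !map_cat !rev_cat.
  have hlt : ((size (p ++ t))./2 <= size (rev (map (@inv_letter X) t)))%N.
    have half_le i j : (2 * i <= i + j -> (i + j)./2 <= j)%N by lia.
    by move: le2; rewrite size_rev size_map Au size_cat; exact: half_le.
  rewrite !takel_cat //.
have : (size p <= (size (A u))./2)%N.
  have half_le i j : (2 * i <= j -> i <= j./2)%N by lia.
  exact: half_le.
move: (size (A u))./2 => h ph; rewrite psiu Au.
have cut z : size z = size p -> word_code (take h (z ++ t)) =
    (word_code z + #|{: letter X}| ^ size p * word_code (take (h - size p) t))%N.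
  by move=> zp; rewrite take_cat zp ltnNge ph /= word_code_cat zp.
rewrite !cut ?size_free_inv_word ?pq //.
by move: (aut_code _) (aut_code _) => *; lia.
Qed.

(** Each of the two cancellations takes at most half of the image of $v$. If together they took
    everything, this image would be $pq$ with equal halves, and [nielsen2_half] for $v$ and for
    $v^{-1}$ would give $p=q^{-1}$, so that the image would be its own inverse. *)
Lemma nielsen2 u v w : u != v -> w != inv_letter v ->
  (lcp (A u) (A v) + lcp (A (inv_letter v)) (A w) < size (A v))%N.
Proof.
move=> uv wv; rewrite ltnNge; apply/negP => le.
have l1 := nielsen1 uv; have l2 := nielsen1 wv.
rewrite size_img_inv lcpC in l2.
have self x : (2 * lcp (A x) (A (inv_letter x)) < size (A x))%N.
  by rewrite img_inv lcp_inv // => /img_neq0.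
have uv1 : u.1 != v.1.
  rewrite idx_eq negb_or uv; apply/eqP => e.
  by have := self v; rewrite lcpC -e; lia.
have wv1 : w.1 != (inv_letter v).1.
  rewrite idx_eq negb_or wv inv_letterK; apply/eqP => e.
  by have := self v; rewrite lcpC -{1}e lcpC; move: le;
    rewrite e [lcp (A (inv_letter v)) _]lcpC; lia.
set l := lcp (A u) (A v) in le l1.
have ll : lcp (A (inv_letter v)) (A w) = l /\ size (A v) = (2 * l)%N by lia.
case: ll => l2E sz.
set p := take l (A v); set q := drop l (A v).
have vE : A v = p ++ q by rewrite cat_take_drop.
have sp : size p = l by rewrite size_takel // sz; lia.
have sq : size q = l by rewrite size_drop sz; lia.
have uE : A u = p ++ drop l (A u) by rewrite /p -take_lcp cat_take_drop.
have vE' : A (inv_letter v) = free_inv_word q ++ free_inv_word p.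
  by rewrite img_inv vE /free_inv_word map_cat rev_cat.
have wE : A w = free_inv_word q ++ drop l (A w).
  rewrite -[LHS](cat_take_drop l) -l2E -take_lcp l2E vE' take_size_cat //.
  by rewrite size_free_inv_word.
have c1 := nielsen2_half uv1 vE uE (etrans sp (esym sq)).
have c2 := nielsen2_half wv1 vE' wE.
move: c1 c2; rewrite lcpC -/l sp !size_free_inv_word sq sp l2E free_inv_wordK =>
  /(_ erefl) c1 /(_ erefl erefl) c2.
have pq : p = free_inv_word q.
  by apply: word_code_inj; [rewrite size_free_inv_word sp sq | lia].
have := self v; rewrite [A (inv_letter v)]vE' vE pq free_inv_wordK lcpxx; lia.
Qed.

(** By [nielsen2] the image of every letter keeps at least one of its own letters in the product, so
    cancellation never reaches beyond the next letter. *)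
Lemma img_reduced_prefix v s : reduced (v :: s) -> exists rest,
  free_word (phi (eval (v :: s))) =
    take (size (A v) - (if s is y :: _ then lcp (A (inv_letter v)) (A y) else 0)) (A v) ++ rest /\
  (size s <= size rest)%N.
Proof.
elim: s v => [|y s IH] v r.
  by exists [::]; rewrite big_seq1 subn0 take_size cats0.
have /andP[yv r'] := r; have [rest [IHe IHs]] := IH y r'.
set c := lcp (A (inv_letter v)) (A y); rewrite big_cons autM free_wordM.
set W := free_word (phi (eval (y :: s))) in IHe *.
set c' := if s is _ :: _ then _ else _ in IHe.
have cc : (c + c' < size (A y))%N.
  have vy : inv_letter v != y by rewrite eq_sym.
  rewrite /c' /c; case: (s) r' => [_|z s'] /=.
    have half_lt i j : (2 * i <= j -> j != 0 -> i + 0 < j)%N by lia.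
    apply: half_lt (nielsen1 vy) _.
    by rewrite size_eq0; apply/eqP/img_neq0.
  by case/andP => zy _; exact: nielsen2.
have rW : reduced W by exact: free_wordP.
(* The cancellation stops inside the surviving part of the image of [y], so it is the same against
   the whole word as against [A y]. *)
have lW : lcp (A (inv_letter v)) W = c.
  apply: (@lcp_take_eq _ _ (A y) _ (size (A y) - c')); first by rewrite -/c; lia.
  by rewrite IHe take_size_cat // size_takel //; lia.
have -> : A v = free_inv_word (A (inv_letter v)) by rewrite img_inv free_inv_wordK.
rewrite free_mulV_lcp // lW free_inv_word_drop size_img_inv.
exists (drop c W); split; first by rewrite size_free_inv_word size_img_inv.
rewrite size_drop IHe size_cat size_takel ?leq_subr //.
have arith i j k l n : (i + j < k -> l <= n -> l.+1 <= k - j + n - i)%N by lia.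
exact: arith.
Qed.

Lemma nielsen_expand f : (size (free_word f) <= size (free_word (phi f)))%N.
Proof.
rewrite [in leqRHS](free_prodE f); have := free_wordP f.
case: (free_word f) => // v s r; have [rest [-> le]] := img_reduced_prefix r.
have nz : size (A v) != 0 by rewrite size_eq0; apply/eqP/img_neq0.
rewrite size_cat size_takel ?leq_subr //=.
have arith i j k l : (i < j -> k <= l -> k.+1 <= j - i + l)%N by lia.
apply: arith le; case: s r => [|y s] r; first by rewrite lt0n.
have half_lt i j : (2 * i <= j -> j != 0 -> i < j)%N by lia.
apply: half_lt nz; rewrite -(size_img_inv _ v) lcpC; apply: nielsen1.
by case/andP: r.
Qed.

Lemma nielsen_minimal_letter_aut : letter_aut phi.
Proof.
rewrite -(invgK phi); apply: letter_autV => x.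
have le := nielsen_expand (phi^-1 (free_gen x)); rewrite autK in le.
have := free_prodE (phi^-1 (free_gen x)); case: (free_word _) le => [|y [|//]] _.
  rewrite big_nil -(morph_group1 (autM phi^-1)) => /aut_inj/(congr1 (@free_word X)).
  by [].
by rewrite big_seq1; exists y.
Qed.

End Minimal.

Theorem nielsen phi :
  exists m, signed_word (@tau_set X) m /\ letter_aut (phi * word_val m).
Proof.
have [m [Sm mm]] := nielsen_minimal_exists phi; exists m; split=> //.
exact: nielsen_minimal_letter_aut.
Qed.

End Nielsen.

(** * The network of planes *)

Section Network.
Variables (R : realType) (X : finType) (G : groupType) (pi : Aut (free_group X) -> G).
Hypothesis cardX : (2 < #|X|)%N.
Hypothesis piM : {morph pi : x y / (x * y)%g}.
Hypothesis pi_surj : forall g, exists f, pi f = g.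
Hypothesis pi_inner : forall f h, pi f = pi h -> exists g, forall z, f z = ((h z) ^ g)%g.
Local Open Scope group_scope.
Local Open Scope classical_set_scope.
Local Notation T := (@tau_letter_set X).
Local Notation piT := (pi @` T).
Implicit Types (a b c d : letter X).

(** The rank hypothesis enters through this choice of a further index, both to find a partner for a
    transvection and to connect transvections to each other. *)
Lemma third_letter a b : exists c, a.1 != c.1 /\ b.1 != c.1.
Proof.
case: (pickP [pred z | (z != a.1) && (z != b.1)]) => [z /andP[za zb]|none].
  by exists (z, false); rewrite /= !(eq_sym _ z).
have : ([set: X] \subset [:: a.1; b.1])%SET.
  apply/fintype.subsetP => z _; rewrite !inE; have := none z.
  by rewrite /= => /negbT; rewrite negb_and !negbK.
move=> /subset_leq_card; rewrite cardsT => /(leq_trans cardX).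
by move=> /leq_trans/(_ (card_size _)); rewrite ltnn.
Qed.

Lemma finite_letter_aut : finite_set (@letter_aut X).
Proof.
pose g (s : {ffun letter X -> letter X}) : Aut (free_group X) :=
  xget 1 [set f : Aut (free_group X) | forall a, f (free_gen a) = free_gen (s a)].
apply: (@sub_finite_set _ _ (g @` setT)); last exact/finite_image/finite_finset.
move=> f /choice[s fs]; exists (finfun s) => //.
apply: xget_unique => [a|h hs] /=; first by rewrite ffunE.
by apply: aut_eq_gen => a; rewrite hs ffunE fs.
Qed.

Lemma finite_tau_set : finite_set (@tau_set X).
Proof.
apply: (@sub_finite_set _ _ ((fun ab => tau ab.1 ab.2) @` setT)).
  by move=> _ [a [b [_ ->]]]; exists (a, b).
exact/finite_image/finite_finset.
Qed.

Lemma signed_word_lift (S : set (Aut (free_group X))) w : signed_word (pi @` S) w ->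
  exists m, [/\ signed_word S m, size m = size w & word_val w = pi (word_val m)].
Proof.
elim: w => [|x w IH] Sw.
  by exists [::]; rewrite /word_val !big_nil (morph_group1 piM).
have [|m [Sm sm e]] := IH; first by move=> y yw; apply: Sw; rewrite inE yw orbT.
have [f [Sf fx]] : exists f, (S f \/ S f^-1) /\ x = pi f.
  have [[f Sf <-]|[f Sf e']] := Sw x (mem_head _ _); first by exists f; split=> //; left.
  exists f^-1; rewrite invgK; split; first by right.
  by rewrite (morph_groupV piM) e' invgK.
exists (f :: m); split; [|by rewrite /= sm|].
- by move=> y; rewrite inE => /orP[/eqP ->//|]; exact: Sm.
- by rewrite /word_val !big_cons piM fx -[X in _ * X]/(word_val w) e.
Qed.

Lemma gen_image (S : set (Aut (free_group X))) m : signed_word S m ->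
  gen (pi @` S) (pi (word_val m)).
Proof.
have [g1 gM gV] := gen_subgroup (pi @` S).
elim: m => [|x m IH] Sm; first by rewrite /word_val big_nil (morph_group1 piM).
rewrite /word_val big_cons piM; apply: gM; last first.
  by apply: IH => y ym; apply: Sm; rewrite inE ym orbT.
have [Sx|Sx] := Sm x (mem_head _ _); first by apply: gen_sub; exists x.
by rewrite -[x]invgK (morph_groupV piM); apply: gV; apply: gen_sub; exists x^-1.
Qed.

(** Signed permutations represent all cosets of the subgroup generated by the transvections.
    Generation, finite index and bounded distance all follow from this. *)
Lemma nielsen_image g : exists h l, [/\ gen (pi @` @tau_set X) h, letter_aut l & g * h = pi l].
Proof.
have [f <-] := pi_surj g; have [m [Sm lm]] := nielsen f.
exists (pi (word_val m)), (f * word_val m); split => //; exact: gen_image.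
Qed.

Lemma generating_piT : finite_generating_set [set: G] piT.
Proof.
split.
  by apply: finite_image; rewrite finite_setU; split;
    [exact: finite_tau_set|exact: finite_letter_aut].
apply/seteqP; split=> // g _; have [h [l [gh ll e]]] := nielsen_image g.
have [g1 gM gV] := gen_subgroup piT.
rewrite -(mulgK h g) e; apply: gM; first by apply: gen_sub; exists l => //; right.
have sub x : (pi @` @tau_set X) x -> piT x by move=> [y Sy <-]; exists y => //; left.
by apply: gV; have [] := word_norm_mul_le (fun x Sx => gen_sub (sub x Sx))
  (fun x Sx => word_norm_gen1 (sub x Sx)) gh.
Qed.

Lemma pi_zpow f p : pi (zpow f p) = zpow (pi f) p.
Proof.
case: p => n /=; first exact: morph_groupX.
by rewrite (morph_groupV piM) (morph_groupX piM).
Qed.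

Lemma pi_zpow2 f h p q : pi (zpow2 f h p q) = zpow2 (pi f) (pi h) p q.
Proof. by rewrite /zpow2 piM !pi_zpow. Qed.

Section GoodPair.
Variables a b c d : letter X.
Hypothesis gp : good_pair a b c d.
Local Notation s := (pi (tau a b)).
Local Notation t := (pi (tau c d)).

Lemma pi_good_pair_commute : commute s t.
Proof. by rewrite /commute -!piM good_pair_commute. Qed.

(** The linear bound, applied to the empty word, forces both exponents to vanish. *)
Lemma pi_good_pair_inj p q : zpow2 s t p q = 1 -> p = 0%R /\ q = 0%R.
Proof.
rewrite -pi_zpow2 => e.
have := @good_pair_linear X G pi piM pi_inner a b c d p q [::] gp.
rewrite /word_val big_nil (morph_group1 piM) e => /(_ _ erefl) /=.
rewrite muln0 leqn0 addn_eq0 !absz_eq0 => H.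
by have /andP[/eqP -> /eqP ->] : (p == 0%R) && (q == 0%R) by apply: H.
Qed.

Lemma pi_good_pair_undistorted : undistorted R (gen [set s; t]).
Proof.
apply: (@undistorted_pair _ _ _ pi_good_pair_commute R _ 2%N generating_piT) => p q.
have gpq : gen piT (zpow2 s t p q) by rewrite generating_piT.2.
have [w [Sw we <-]] := word_normP gpq.
have [m [Sm <- e]] := signed_word_lift Sw.
by apply: (good_pair_linear piM pi_inner gp Sm); rewrite -e we pi_zpow2.
Qed.

Lemma pi_good_pair_unconstricted : unconstricted R (gen [set s; t]).
Proof. exact: unconstricted_pair pi_good_pair_commute pi_good_pair_inj. Qed.

End GoodPair.

Definition tau_planes : set (set G) :=
  [set H | exists a b c d, good_pair a b c d /\ H = gen [set pi (tau a b); pi (tau c d)]].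

Lemma finite_tau_planes : finite_set tau_planes.
Proof.
apply: (@sub_finite_set _ _
  ((fun z => gen [set pi (tau z.1.1 z.1.2); pi (tau z.2.1 z.2.2)]) @` setT)).
  by move=> _ [a [b [c [d [_ ->]]]]]; exists ((a, b), (c, d)).
exact/finite_image/finite_finset.
Qed.

Definition joined (H H' : set G) := exists (k : nat) (K : nat -> set G),
  [/\ K 0%N = H, K k = H', forall i, (i <= k)%N -> tau_planes (K i) &
      forall i, (i < k)%N -> infinite_set (K i `&` K i.+1)].

Lemma joined_trans H1 H2 H3 : joined H1 H2 -> joined H2 H3 -> joined H1 H3.
Proof.
move=> [k [K [K0 Kk HK iK]]] [l [L [L0 Ll HL iL]]].
exists (k + l)%N, (fun i => if (i <= k)%N then K i else L (i - k)%N); split.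
- by [].
- case: leqP => [lk|_]; last by rewrite addKn.
  have l0 : l = 0%N by lia.
  by rewrite l0 addn0 Kk -L0 -Ll l0.
- by move=> i ikl; case: leqP => [/HK//|ki]; apply: HL; lia.
- move=> i ikl; case: (ltngtP i k) => [ik|ki|ik].
  + exact: iK.
  + by rewrite subSn; [apply: iL; lia|lia].
  + by rewrite ik Kk -L0 subSnn; apply: iL; lia.
Qed.

(* [tau a b] and [tau c d] are vertices of a connected graph whose edges are the good
   pairs; an edge is a member of [tau_planes], and adjacent edges share the infinite
   cyclic group generated by their common vertex. *)
Definition linked a b c d := forall H H', tau_planes H -> tau_planes H' ->
  H (pi (tau a b)) -> H' (pi (tau c d)) -> joined H H'.

Lemma tau_plane_exists a b : a.1 != b.1 ->
  exists2 H, tau_planes H & H (pi (tau a b)).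
Proof.
move=> ab; have [c [ac bc]] := third_letter a b.
exists (gen [set pi (tau a b); pi (tau c b)]); last by apply: gen_sub; left.
exists a, b, c, b; split=> //.
rewrite /good_pair ab (eq_sym c.1) bc (negPf ac) /= !andbT.
by apply: contraNneq ac => ->.
Qed.

Lemma tau_expg_inj a b : a.1 != b.1 -> injective (fun n : nat => pi (tau a b) ^+ n).
Proof.
move=> ab m n e; have [c [ac bc]] := third_letter a b.
have gp : good_pair a b c b.
  rewrite /good_pair ab (eq_sym c.1) bc (negPf ac) /= !andbT.
  by apply: contraNneq ac => ->.
have := @zpow2_inj _ _ _ (pi_good_pair_commute gp) (pi_good_pair_inj gp) (Posz m) 0%R (Posz n) 0%R.
by rewrite /zpow2 /= e => /(_ erefl)[[]].
Qed.

Lemma linked_refl a b : a.1 != b.1 -> linked a b a b.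
Proof.
move=> ab H H' hH hH' Hab Hab'; exists 1%N, (fun i => if i == 0%N then H else H'); split=> //.
  by case=> [|[]].
case=> //= _; apply: (infinite_seq (tau_expg_inj ab)) => n.
have aux K : tau_planes K -> K (pi (tau a b)) -> K (pi (tau a b) ^+ n).
  by move=> [a' [b' [c' [d' [_ ->]]]]]; exact: gen_expg.
by split; exact: aux.
Qed.

Lemma linked_trans a b c d a' b' : c.1 != d.1 -> linked a b c d -> linked c d a' b' ->
  linked a b a' b'.
Proof.
move=> /tau_plane_exists[K hK Kcd] l1 l2 H H' hH hH' Hab Hab'.
exact: joined_trans (l1 _ _ hH hK Hab Kcd) (l2 _ _ hK hH' Kcd Hab').
Qed.

Lemma linked_good_pair a b c d : good_pair a b c d -> linked a b c d.
Proof.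
move=> gp H H' hH hH' Hab Hcd; have /and5P[_ ab _ _ /andP[cd _]] := gp.
set K := gen [set pi (tau a b); pi (tau c d)].
have hK : tau_planes K by exists a, b, c, d.
apply: (@joined_trans _ K).
  by apply: (linked_refl ab) => //; apply: gen_sub; left.
by apply: (linked_refl cd) => //; apply: gen_sub; right.
Qed.

Lemma linked_left_neq a b c : a.1 != b.1 -> c.1 != b.1 -> a.1 != c.1 -> linked a b c b.
Proof.
move=> ab cb ac; apply: linked_good_pair; rewrite /good_pair ab cb (negPf ac) /= !andbT.
by apply: contraNneq ac => ->.
Qed.

Lemma linked_left a b c : a.1 != b.1 -> c.1 != b.1 -> linked a b c b.
Proof.
move=> ab cb; have [ac|ac] := eqVneq a.1 c.1; last exact: linked_left_neq.
have [e [ae be]] := third_letter a b; rewrite eq_sym in be.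
apply: (@linked_trans _ _ e b) => //; first exact: linked_left_neq.
by apply: linked_left_neq => //; rewrite -ac eq_sym.
Qed.

(** The multiplier is changed by passing to the other side of $a$: [tau a b] commutes with
    [tau (inv_letter a) d], from which [linked_left] returns to [a]. *)
Lemma linked_right_neq a b d : a.1 != b.1 -> a.1 != d.1 -> b.1 != d.1 -> linked a b a d.
Proof.
move=> ab ad bd; apply: (@linked_trans _ _ (inv_letter a) d) => //; last exact: linked_left.
apply: linked_good_pair; rewrite /good_pair /= ab ad bd eqxx /= andbT.
by rewrite eq_sym inv_letter_neq.
Qed.

Lemma linked_right a b d : a.1 != b.1 -> a.1 != d.1 -> linked a b a d.
Proof.
move=> ab ad; have [bd|bd] := eqVneq b.1 d.1; last exact: linked_right_neq.
have [e [ae be]] := third_letter a b.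
apply: (@linked_trans _ _ a e) => //; first exact: linked_right_neq.
by apply: linked_right_neq => //; rewrite -bd eq_sym.
Qed.

(** A letter [k] with index distinct from those of $b$ and $d$ can carry both multipliers: the chain
    goes through [tau k b] and [tau k d]. *)
Lemma linked_all a b c d : a.1 != b.1 -> c.1 != d.1 -> linked a b c d.
Proof.
move=> ab cd; have [k [bk dk]] := third_letter b d.
rewrite eq_sym in bk; rewrite eq_sym in dk.
apply: (@linked_trans _ _ k b) => //; first exact: linked_left.
by apply: (@linked_trans _ _ k d) => //; [exact: linked_right|exact: linked_left].
Qed.

Lemma thick_of_aut_quotient : algebraically_thick_order_le1 R G.
Proof.
have [x [y xy]] : exists x y : X, x != y.
  have /card_gt0P[x _] : (0 < #|X|)%N by exact: leq_trans cardX.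
  by have [c [xc _]] := third_letter (x, false) (x, false); exists x, c.1.
(* Every element is at distance at most 1 from the transvection subgroup, and the network condition
   is a strict inequality, whence 2. *)
right; exists 2%:R%R, tau_planes; split.
  by move=> H [a [b [c [d [gp ->]]]]]; exact: pi_good_pair_unconstricted.
split.
- by rewrite ltr0n.
- split; first exact: finite_tau_planes.
    by have [H hH _] := @tau_plane_exists (x, false) (y, false) xy; exists H.
  by move=> H [a [b [c [d [gp ->]]]]]; exact: gen_subgroup.
- move=> H [a [b [c [d [gp ->]]]]]; split; last exact: pi_good_pair_undistorted.
  by eexists; exact: finite_generating_pair.
- exists (gen (pi @` @tau_set X)); split; first exact: gen_subgroup.
  + apply: (@sub_finite_set _ _
      ((fun l => [set pi l * h | h in gen (pi @` @tau_set X)]) @` (@letter_aut X))); last first.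
      exact/finite_image/finite_letter_aut.
    have [g1 gM gV] := gen_subgroup (pi @` @tau_set X).
    move=> _ [g _ <-]; have [h [l [gh ll e]]] := nielsen_image g.
    exists l => //; apply/seteqP; split=> _ [k gk <-].
      by exists (h * k); [exact: gM|rewrite mulgA e].
    by exists (h^-1 * k); [apply: gM => //; exact: gV|rewrite mulgA -(mulgK h g) e].
  + exists piT; split; first exact: generating_piT.
    (* Starting from the inverse of [g] makes $g^{-1}h$ the image of a signed permutation, hence a
       generator of the word metric in use. *)
    move=> g; have [h [l [gh ll e]]] := nielsen_image g^-1; exists h => //.
    by rewrite ltr_nat ltnS /word_dist e word_norm_gen1 //; exists l => //; right.
  + exists (pi @` @tau_set X); split.
      by split=> //; exact/finite_image/finite_tau_set.
    move=> _ [_ [a [b [ab ->]]] <-]; have [H hH Hab] := tau_plane_exists ab.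
    by exists H.
- move=> H H' hH hH'.
  have [a [b [c [d [gp eH]]]]] := hH; have [a' [b' [c' [d' [gp' eH']]]]] := hH'.
  have /and5P[_ ab _ _ _] := gp; have /and5P[_ ab' _ _ _] := gp'.
  apply: (linked_all ab ab') => //; first by rewrite eH; apply: gen_sub; left.
  by rewrite eH'; apply: gen_sub; left.
Qed.

End Network.

Theorem theorem9p2 (R : realType) (n : nat) (hn : (3 <= n)%N) :
  algebraically_thick_order_le1 R (Aut (free_group 'I_n)) /\
  algebraically_thick_order_le1 R (Out (free_group 'I_n)).
Proof.
have cardI : (2 < #|{: 'I_n}|)%N by rewrite card_ord.
split.
  apply: (@thick_of_aut_quotient R _ (Aut (free_group 'I_n)) id) => //.
    by move=> g; exists g.
  by move=> f _ <-; exists 1%g => z; rewrite conjg1.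
apply: (@thick_of_aut_quotient R _ (Out (free_group 'I_n)) (@out_class _)) => //.
- by move=> f h; rewrite -out_classM.
- by move=> g; exists (repr g); exact: out_classK.
(* Here $h^{-1}f$ is conjugation by $g$, and applying $h$ afterwards turns the conjugator into
   $h(g)$. *)
- move=> f h /esym/out_classP[g hg]; exists (h g) => z.
  by rewrite -[f z](autK h) -[h^-1%g (f z)]aut_mulE hg /conjg !autM (morph_groupV (autM h)).
Qed.
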